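(* Fix $\delta\in[0,1]$ and consider the adder-erasure RAC: for each $k$, the inputs satisfy $X_1,\dots,X_k\in\{0,1\}$, and the output is $$Y_k=\begin{cases}\sum_{i=1}^kX_i & \text{with probability }1-\delta,\\ \mathsf e & \text{with probability }\delta,\end{cases}$$ with output alphabet $\{0,\dots,k\}\cup\{\mathsf e\}$. For each $k$, the mutual information $I_k(X_{[k]};Y_k)$, maximized over independent input distributions $P_{X_1}\times\dots\times P_{X_k}$, is attained when every $X_i\sim\mathrm{Bernoulli}(1/2)$. Under this input distribution, as $k\to\infty$ (natural logarithms), $$I_k(X_{[k]};Y_k)=(1-\delta)\Big(\frac12\ln\frac{\pi ek}2-\frac1{12k^2}\Big)+O(k^{-3})\ \text{nats},$$ $$V_k=(1-\delta)\Big[\frac\delta4\ln^2\frac{\pi ek}2+\frac12-\frac1{2k}-\Big(\frac12+\frac{\delta\ln\frac{\pi ek}2}{12}\Big)\frac1{k^2}\Big]+O\Big(\frac{\ln k}{k^3}\Big)\ \text{nats}^2,$$ where $V_k=\mathrm{Var}[\imath_k(X_{[k]};Y_k)]$.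
   Context: The information density is $\imath_k(x_{[k]};y)=\ln\frac{P_{Y_k|X_{[k]}}(y|x_{[k]})}{P_{Y_k}(y)}$, and $I_k(X_{[k]};Y_k)=\mathbb E[\imath_k(X_{[k]};Y_k)]$, both computed under the stated input distribution. *)

(* Defs.v *)
From Stdlib Require Import Reals List.
Open Scope R_scope.

Definition lsum {A : Type} (l : list A) (f : A -> R) : R :=
  fold_right Rplus 0 (map f l).

Fixpoint blists (k : nat) : list (list bool) :=
  match k with
  | O => nil :: nil
  | S k' => map (cons false) (blists k') ++ map (cons true) (blists k')
  end.

Definition bsum (x : list bool) : nat := count_occ Bool.bool_dec x true.

(* output alphabet {0,...,k} ∪ {e}; None is the erasure symbol e *)
Definition outputs (k : nat) : list (option nat) :=
  None :: map Some (seq 0 (S k)).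

Definition W (delta : R) (x : list bool) (y : option nat) : R :=
  match y with
  | None => delta
  | Some s => if Nat.eqb s (bsum x) then 1 - delta else 0
  end.

(* product input distribution: X_i ~ Bernoulli(p i), i = 0..k-1 (0-indexed) *)
Fixpoint PXaux (p : nat -> R) (i : nat) (x : list bool) : R :=
  match x with
  | nil => 1
  | b :: x' => (if b then p i else 1 - p i) * PXaux p (S i) x'
  end.
Definition PX (p : nat -> R) (x : list bool) : R := PXaux p 0 x.

Definition PY (delta : R) (p : nat -> R) (k : nat) (y : option nat) : R :=
  lsum (blists k) (fun x => PX p x * W delta x y).

Definition infodens (delta : R) (p : nat -> R) (k : nat)
  (x : list bool) (y : option nat) : R :=
  ln (W delta x y / PY delta p k y).

(* expectation under the joint distribution P_X(x) W(y|x);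
   zero-probability pairs contribute 0 *)
Definition Ejoint (delta : R) (p : nat -> R) (k : nat)
  (f : list bool -> option nat -> R) : R :=
  lsum (blists k) (fun x => lsum (outputs k)
    (fun y => PX p x * W delta x y * f x y)).

Definition MI (delta : R) (p : nat -> R) (k : nat) : R :=
  Ejoint delta p k (infodens delta p k).

Definition Vdisp (delta : R) (p : nat -> R) (k : nat) : R :=
  Ejoint delta p k (fun x y => (infodens delta p k x y - MI delta p k) ^ 2).

Definition half : nat -> R := fun _ => 1 / 2.

(* Main.v *)
Require Import Defs.
From Coquelicot Require Import Coquelicot.
From Stdlib Require Import Reals Lra Lia List Permutation Factorial.
Open Scope R_scope.

(** The information density is [0] at an erasure and [- ln P(S)] otherwise,
    where [S] is the sum of the inputs and [P] its law, so
    [MI = (1 - delta) H(S)] and [V = (1 - delta) (Var (- ln P(S)) + delta H(S)^2)].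

    Maximality.  Let [a] be the mean of the parameters [p i].  By Gibbs'
    inequality [H(S)] is at most the cross entropy with respect to [Bin(k, a)];
    since [- ln] of the binomial mass function is convex, Hoeffding's
    comparison bounds this by [H(Bin(k, a))].  For [a <= 1/2], with
    [g a = E ln(S + 1)], [S ~ Bin(k - 1, a)], the derivative of [H(Bin(k, a))] is
    [k ((g a - ln a) - (g (1 - a) - ln (1 - a)))], which is nonnegative because
    [g a - ln a] is decreasing.

    Asymptotics.  With [z = 2 s - k], Stirling's formula with its [1/(12 n)] term
    gives [- ln P(s) = ln(pi k / 2) / 2 + M(z) + R], [M] an even polynomial of
    degree 6 and [|R| <= C (k^-3 + z^4/k^5 + z^6/k^6 + z^8/k^7)].  The bound holds
    for every [s]: when [|z| > k/2] everything is [O(k) = O(z^8/k^7)], so no tail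
    estimate is needed, and the exact moments of [z] up to order 12 finish. *)

(** * Sums of independent Bernoulli variables *)

(* [EF l f] is the expectation of [f S], [S] a sum of independent Bernoulli
   variables whose parameters are listed in [l]. *)
Fixpoint EF (l : list R) (f : nat -> R) : R :=
  match l with
  | nil => f O
  | a :: l' => (1 - a) * EF l' f + a * EF l' (fun n => f (S n))
  end.

Definition mass (l : list R) (s : nat) : R :=
  EF l (fun n => if Nat.eqb s n then 1 else 0).

(** At a point of zero mass the default value of [ln (/ 0)] has weight zero under [EF], which
    implements [0 ln 0 = 0]. *)
Definition entropy (l : list R) : R := EF l (fun s => ln (/ mass l s)).

Definition prob_list (l : list R) : Prop := Forall (fun a => 0 <= a <= 1) l.

Lemma EF_ext (l : list R) : forall f g,
  (forall n, (n <= length l)%nat -> f n = g n) -> EF l f = EF l g.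
Proof.
  induction l as [|a l IH]; simpl; intros f g H; [apply H; lia|].
  rewrite (IH f g), (IH (fun n => f (S n)) (fun n => g (S n))); auto;
    intros; apply H; lia.
Qed.

Lemma EF_plus (l : list R) : forall f g, EF l (fun n => f n + g n) = EF l f + EF l g.
Proof.
  induction l as [|a l IH]; simpl; intros f g; [ring|].
  rewrite IH, (IH (fun n => f (S n))); ring.
Qed.

Lemma EF_scal (l : list R) (c : R) : forall f, EF l (fun n => c * f n) = c * EF l f.
Proof.
  induction l as [|a l IH]; simpl; intros f; [ring|].
  rewrite IH, (IH (fun n => f (S n))); ring.
Qed.

Lemma EF_const (l : list R) (c : R) : EF l (fun _ => c) = c.
Proof. induction l as [|a l IH]; simpl; [reflexivity|]; rewrite IH; ring. Qed.

Lemma EF_minus (l : list R) f g : EF l (fun n => f n - g n) = EF l f - EF l g.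
Proof.
  replace (EF l f - EF l g) with (EF l f + (-1) * EF l g) by ring.
  rewrite <- EF_scal, <- EF_plus; apply EF_ext; intros; ring.
Qed.

Lemma EF_le (l : list R) : prob_list l -> forall f g,
  (forall n, (n <= length l)%nat -> f n <= g n) -> EF l f <= EF l g.
Proof.
  intros Hl; induction Hl as [|a l Ha Hl IH]; simpl; intros f g H; [apply H; lia|].
  apply Rplus_le_compat; apply Rmult_le_compat_l; try lra; apply IH;
    intros; apply H; lia.
Qed.

Lemma EF_abs_le (l : list R) : prob_list l -> forall f g,
  (forall n, (n <= length l)%nat -> Rabs (f n) <= g n) -> Rabs (EF l f) <= EF l g.
Proof.
  intros Hl f g H; apply Rabs_le; split.
  - replace (- EF l g) with ((-1) * EF l g) by ring; rewrite <- EF_scal.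
    apply EF_le; auto; intros n Hn; generalize (Rabs_le_between (f n) (g n)); intros [K _].
    specialize (K (H n Hn)); lra.
  - apply EF_le; auto; intros n Hn; generalize (Rabs_le_between (f n) (g n)); intros [K _].
    specialize (K (H n Hn)); lra.
Qed.

Lemma EF_perm (l l' : list R) : Permutation l l' -> forall f, EF l f = EF l' f.
Proof.
  induction 1; simpl; intros f; [reflexivity| | |].
  - rewrite IHPermutation, (IHPermutation (fun n => f (S n))); reflexivity.
  - ring.
  - rewrite IHPermutation1; auto.
Qed.

Lemma EF_sum (l : list R) (N : nat) (F : nat -> nat -> R) :
  EF l (fun n => sum_f_R0 (fun s => F s n) N) = sum_f_R0 (fun s => EF l (F s)) N.
Proof.
  induction N as [|N IH]; simpl; [reflexivity|].
  rewrite EF_plus, IH; reflexivity.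
Qed.

Lemma sum_indicator (f : nat -> R) (n N : nat) :
  sum_f_R0 (fun s => f s * (if Nat.eqb s n then 1 else 0)) N
  = if Nat.leb n N then f n else 0.
Proof.
  induction N as [|N IH].
  - simpl; destruct n; simpl; ring.
  - rewrite tech5, IH.
    destruct (Nat.leb_spec n N), (Nat.leb_spec n (S N)), (Nat.eqb_spec (S N) n);
      try lia; subst; ring.
Qed.

(** Expand [f] on [0..length l] in indicators and exchange the finite sum with [EF]. This passes
    from the recursive expectation to a sum against the law. *)
Lemma EF_mass (l : list R) (f : nat -> R) :
  EF l f = sum_f_R0 (fun s => mass l s * f s) (length l).
Proof.
  transitivity (EF l (fun n => sum_f_R0
    (fun s => f s * (if Nat.eqb s n then 1 else 0)) (length l))).
  - apply EF_ext; intros n Hn; rewrite sum_indicator.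
    apply Nat.leb_le in Hn; rewrite Hn; reflexivity.
  - rewrite EF_sum; apply sum_eq; intros s _; rewrite EF_scal; unfold mass; ring.
Qed.

Lemma sum_mass (l : list R) : sum_f_R0 (mass l) (length l) = 1.
Proof.
  rewrite <- (EF_const l 1), EF_mass; apply sum_eq; intros; ring.
Qed.

Lemma mass_ge0 (l : list R) (s : nat) : prob_list l -> 0 <= mass l s.
Proof.
  intros Hl; rewrite <- (EF_const l 0); apply EF_le; auto; intros n _.
  destruct (Nat.eqb s n); lra.
Qed.

(** * Reduction of the channel to the law of the input sum *)

Lemma lsum_app {A : Type} (l l' : list A) f : lsum (l ++ l') f = lsum l f + lsum l' f.
Proof.
  unfold lsum; induction l as [|a l IH]; simpl; [ring|rewrite IH; ring].
Qed.

Lemma lsum_map {A B : Type} (h : A -> B) (l : list A) f :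
  lsum (map h l) f = lsum l (fun a => f (h a)).
Proof. unfold lsum; rewrite map_map; reflexivity. Qed.

Lemma lsum_ext {A : Type} (l : list A) f g :
  (forall a, In a l -> f a = g a) -> lsum l f = lsum l g.
Proof. intros H; unfold lsum; f_equal; apply map_ext_in; exact H. Qed.

Lemma lsum_scal {A : Type} (l : list A) c f : lsum l (fun a => c * f a) = c * lsum l f.
Proof. unfold lsum; induction l as [|a l IH]; simpl; [ring|rewrite IH; ring]. Qed.

Lemma lsum_seq (f : nat -> R) (N : nat) : lsum (seq 0 (S N)) f = sum_f_R0 f N.
Proof.
  induction N as [|N IH]; [unfold lsum; simpl; ring|].
  rewrite seq_S, lsum_app, IH; unfold lsum; simpl; ring.
Qed.

Lemma bsum_le (k : nat) (x : list bool) : In x (blists k) -> (bsum x <= k)%nat.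
Proof.
  revert x; induction k as [|k IH]; simpl; intros x Hx.
  - destruct Hx as [<-|[]]; reflexivity.
  - apply in_app_iff in Hx; destruct Hx as [Hx|Hx]; apply in_map_iff in Hx;
      destruct Hx as [z [<- Hz]]; apply IH in Hz; unfold bsum in *; simpl; lia.
Qed.

(** The start index [i] is general because [PXaux] shifts it at each bit; splitting on the first bit
    matches the recursion of [EF]. *)
Lemma lsum_blists (p : nat -> R) (k : nat) : forall i g,
  lsum (blists k) (fun x => PXaux p i x * g (bsum x)) = EF (map p (seq i k)) g.
Proof.
  induction k as [|k IH]; intros i g; simpl.
  - unfold lsum; simpl; unfold bsum; simpl; ring.
  - rewrite lsum_app, !lsum_map; simpl; rewrite <- !IH, <- !lsum_scal.
    f_equal; apply lsum_ext; intros x _; unfold bsum; simpl; ring.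
Qed.

Lemma PY_None delta p k : PY delta p k None = delta.
Proof.
  unfold PY; simpl; unfold PX.
  rewrite (lsum_blists p k 0 (fun _ => delta)); apply EF_const.
Qed.

Lemma PY_Some delta p k s :
  PY delta p k (Some s) = (1 - delta) * mass (map p (seq 0 k)) s.
Proof.
  unfold PY, PX, mass; rewrite <- EF_scal, <- lsum_blists.
  apply lsum_ext; intros x _; simpl; destruct (Nat.eqb s (bsum x)); ring.
Qed.

(** Given [x], only the erasure and the output [bsum x] can have nonzero weight, so [f] is
    prescribed at these outputs alone. *)
Lemma Ejoint_EF delta p k f a g :
  (forall x, f x None = a) ->
  (forall x s, s = bsum x -> f x (Some s) = g s) ->
  Ejoint delta p k f = delta * a + (1 - delta) * EF (map p (seq 0 k)) g.
Proof.
  intros Ha Hg; unfold Ejoint.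
  rewrite <- (EF_const (map p (seq 0 k)) a) at 1.
  rewrite <- !EF_scal, <- EF_plus, <- lsum_blists.
  apply lsum_ext; intros x Hx; fold (PX p x); unfold outputs.
  change (lsum (None :: map Some (seq 0 (S k))) (fun y => PX p x * W delta x y * f x y))
    with (PX p x * delta * f x None
      + lsum (map Some (seq 0 (S k))) (fun y => PX p x * W delta x y * f x y)).
  rewrite lsum_map, lsum_seq, Ha.
  rewrite (sum_eq _ (fun s => (PX p x * (1 - delta) * g s)
    * (if Nat.eqb s (bsum x) then 1 else 0))).
  - rewrite sum_indicator; apply bsum_le, Nat.leb_le in Hx; rewrite Hx; ring.
  - intros s _; simpl; destruct (Nat.eqb_spec s (bsum x)) as [E|E]; [rewrite Hg by exact E|]; ring.
Qed.

Lemma infodens_None delta p k x : delta <> 0 -> infodens delta p k x None = 0.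
Proof.
  intros H; unfold infodens; rewrite PY_None; simpl.
  replace (delta / delta) with 1 by (field; exact H); apply ln_1.
Qed.

Lemma infodens_Some delta p k x s : delta <> 1 -> s = bsum x ->
  infodens delta p k x (Some s) = ln (/ mass (map p (seq 0 k)) s).
Proof.
  intros H ->; unfold infodens; rewrite PY_Some; simpl; rewrite Nat.eqb_refl.
  unfold Rdiv; rewrite Rinv_mult, <- Rmult_assoc, Rinv_r by lra; f_equal; ring.
Qed.

(** A general [F] serves both the mean and the variance. At [delta = 0] the erasure density
    degenerates to [ln (0 / 0)], at [delta = 1] the other densities do; each is then multiplied by
    zero. *)
Lemma Ejoint_infodens delta p k (F : R -> R) :
  Ejoint delta p k (fun x y => F (infodens delta p k x y))
  = delta * F 0 + (1 - delta) * EF (map p (seq 0 k)) (fun s => F (ln (/ mass (map p (seq 0 k)) s))).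
Proof.
  destruct (Req_dec delta 0) as [->|H0]; [|destruct (Req_dec delta 1) as [->|H1]].
  - rewrite (Ejoint_EF 0 p k _ (F (ln (0 / 0))) (fun s => F (ln (/ mass (map p (seq 0 k)) s)))).
    + ring.
    + intros x; unfold infodens; rewrite PY_None; reflexivity.
    + intros x s E; rewrite infodens_Some; auto; lra.
  - rewrite (Ejoint_EF 1 p k _ (F 0) (fun s => F (ln (0 / ((1 - 1) * mass (map p (seq 0 k)) s))))).
    + ring.
    + intros x; rewrite infodens_None; [reflexivity|lra].
    + intros x s ->; unfold infodens; rewrite PY_Some; simpl; rewrite Nat.eqb_refl.
      do 3 f_equal; ring.
  - apply Ejoint_EF; intros.
    + rewrite infodens_None; auto.
    + rewrite infodens_Some; auto.
Qed.

Lemma MI_entropy delta p k : MI delta p k = (1 - delta) * entropy (map p (seq 0 k)).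
Proof.
  refine (eq_trans (Ejoint_infodens delta p k (fun r => r)) _); unfold entropy; ring.
Qed.

Lemma Vdisp_entropy delta p k :
  let l := map p (seq 0 k) in
  Vdisp delta p k = (1 - delta) *
    (EF l (fun s => ln (/ mass l s) ^ 2) - (1 - delta) * entropy l ^ 2).
Proof.
  intros l; unfold Vdisp.
  rewrite (Ejoint_infodens delta p k (fun r => (r - MI delta p k) ^ 2)), MI_entropy; fold l.
  rewrite (EF_ext l _ (fun s => (ln (/ mass l s) ^ 2
    + (- 2 * ((1 - delta) * entropy l)) * ln (/ mass l s)) + ((1 - delta) * entropy l) ^ 2))
    by (intros; ring).
  rewrite !EF_plus, EF_scal, EF_const; fold (entropy l); ring.
Qed.

(** * Hoeffding's comparison with the binomial law *)

Definition list_sum_R (l : list R) : R := fold_right Rplus 0 l.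

(** The condition stops at [N] because it will be applied to [- ln] of a binomial mass, which takes
    a default value outside the support. *)
Definition convex_upto (N : nat) (f : nat -> R) : Prop :=
  forall n, (S (S n) <= N)%nat -> 2 * f (S n) <= f n + f (S (S n)).

Lemma list_sum_R_perm l l' : Permutation l l' -> list_sum_R l = list_sum_R l'.
Proof. induction 1; simpl; lra. Qed.

Lemma exists_le_mean (l : list R) (a : R) : l <> nil ->
  list_sum_R l <= a * INR (length l) -> exists x, In x l /\ x <= a.
Proof.
  induction l as [|x l IH]; [congruence|]; intros _ H.
  destruct (Rle_dec x a) as [Hx|Hx]; [exists x; simpl; auto|].
  destruct l as [|y l]; [simpl in H; lra|].
  destruct IH as [z [Hz Hza]]; [discriminate| |exists z; simpl in *; auto].
  change (length (x :: y :: l)) with (S (length (y :: l))) in H.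
  change (list_sum_R (x :: y :: l)) with (x + list_sum_R (y :: l)) in H.
  rewrite S_INR in H; lra.
Qed.

Lemma exists_ge_mean (l : list R) (a : R) : l <> nil ->
  a * INR (length l) <= list_sum_R l -> exists x, In x l /\ a <= x.
Proof.
  induction l as [|x l IH]; [congruence|]; intros _ H.
  destruct (Rle_dec a x) as [Hx|Hx]; [exists x; simpl; auto|].
  destruct l as [|y l]; [simpl in H; lra|].
  destruct IH as [z [Hz Hza]]; [discriminate| |exists z; simpl in *; auto].
  change (length (x :: y :: l)) with (S (length (y :: l))) in H.
  change (list_sum_R (x :: y :: l)) with (x + list_sum_R (y :: l)) in H.
  rewrite S_INR in H; lra.
Qed.

Lemma in_permutation_cons (x : R) (l : list R) :
  In x l -> exists l', Permutation l (x :: l').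
Proof.
  intros H; destruct (in_split _ _ H) as [l1 [l2 ->]].
  exists (l1 ++ l2); symmetry; apply Permutation_middle.
Qed.

(** The difference of the two sides is [(a - x) * (y - a)] times the expected second difference of
    [f] over the remaining variables. *)
Lemma convex_swap (l : list R) (x y a : R) (f : nat -> R) :
  prob_list l -> convex_upto (S (S (length l))) f -> x <= a -> a <= y ->
  EF (x :: y :: l) f <= EF (a :: (x + y - a) :: l) f.
Proof.
  intros Hl Hf Hx Hy; simpl.
  assert (H : 0 <= EF l f + EF l (fun n => f (S (S n))) - 2 * EF l (fun n => f (S n))).
  { rewrite <- EF_scal, <- EF_plus, <- EF_minus, <- (EF_const l 0).
    apply EF_le; auto; intros n Hn; specialize (Hf n ltac:(lia)); lra. }
  assert (H' : 0 <= (a - x) * (y - a)) by (apply Rmult_le_pos; lra).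
  assert (H2 := Rmult_le_pos _ _ H' H).
  match goal with |- ?A <= ?B => assert (E : B - A =
    (a - x) * (y - a) * (EF l f + EF l (fun n => f (S (S n))) - 2 * EF l (fun n => f (S n)))) by ring end.
  lra.
Qed.

(* Hoeffding: replacing a pair [x <= a <= y] by [a, x + y - a] raises the
   expectation of a convex function and fixes one more coordinate at the mean. *)
Lemma EF_convex_le_binomial (a : R) (n : nat) : forall (l : list R) (f : nat -> R),
  length l = n -> prob_list l -> convex_upto n f -> list_sum_R l = a * INR n ->
  0 <= a <= 1 -> EF l f <= EF (repeat a n) f.
Proof.
  induction n as [|n IH]; intros l f Hn Hl Hf Hs Ha.
  - destruct l; [simpl; lra|discriminate].
  - assert (Hnil : l <> nil) by (destruct l; discriminate).
    destruct (exists_le_mean l a Hnil) as [x [Hx Hxa]]; [rewrite Hn; lra|].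
    destruct (in_permutation_cons _ _ Hx) as [l1 P1].
    rewrite (EF_perm _ _ P1).
    assert (L1 := Permutation_length P1); rewrite Hn in L1; simpl in L1.
    assert (Hl1 : prob_list (x :: l1)) by (unfold prob_list in *; rewrite <- P1; exact Hl).
    assert (S1 := list_sum_R_perm _ _ P1); rewrite Hs, S_INR in S1;
      change (list_sum_R (x :: l1)) with (x + list_sum_R l1) in S1.
    inversion Hl1 as [|? ? Hx01 Hl1']; subst.
    (* A single entry must equal the mean. Otherwise, as [x <= a], the other entries average at
       least [a] and supply the partner [y]. *)
    destruct (Nat.eq_dec n 0) as [->|Hn0].
    + destruct l1; [|discriminate]; simpl in S1; simpl.
      replace x with a by lra; lra.
    + destruct (exists_ge_mean l1 a) as [y [Hy Hya]].
      { destruct l1; simpl in L1; [lia|discriminate]. }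
      { replace (length l1) with n by lia; lra. }
      destruct (in_permutation_cons _ _ Hy) as [l2 P2].
      assert (L2 := Permutation_length P2); simpl in L2.
      assert (Hl2 : prob_list (y :: l2)) by (unfold prob_list in *; rewrite <- P2; exact Hl1').
      assert (S2 := list_sum_R_perm _ _ P2);
        change (list_sum_R (y :: l2)) with (y + list_sum_R l2) in S2.
      inversion Hl2 as [|? ? Hy01 Hl2']; subst.
      rewrite (EF_perm _ _ (perm_skip x P2)).
      eapply Rle_trans.
      { apply (convex_swap l2 x y a); auto.
        intros m Hm; apply Hf; lia. }
      (* Both sides now start with [a], so the induction hypothesis applies to the tails, once for
         [f] and once for its shift. *)
      change (EF (repeat a (S n)) f) with
        ((1 - a) * EF (repeat a n) f + a * EF (repeat a n) (fun m => f (S m))).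
      change (EF (a :: x + y - a :: l2) f) with
        ((1 - a) * EF (x + y - a :: l2) f + a * EF (x + y - a :: l2) (fun m => f (S m))).
      assert (Hl' : prob_list (x + y - a :: l2)) by (constructor; [lra|exact Hl2']).
      assert (Hs' : list_sum_R (x + y - a :: l2) = a * INR n).
      { change (list_sum_R (x + y - a :: l2)) with (x + y - a + list_sum_R l2); lra. }
      apply Rplus_le_compat; apply Rmult_le_compat_l; try lra; apply IH; auto;
        try (simpl; lia); intros m Hm; apply Hf; lia.
Qed.

(** * Gibbs' inequality and the binomial mass function *)

Lemma gibbs_term (m q : R) : 0 <= m -> 0 < q -> m * ln (/ m) - m * ln (/ q) <= q - m.
Proof.
  intros [Hm|<-] Hq; [|rewrite Rmult_0_l; lra].
  replace (m * ln (/ m) - m * ln (/ q)) with (m * ln (q / m)).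
  - assert (H : ln (q / m) <= q / m - 1).
    { assert (Hqm : 0 < q / m) by (apply Rdiv_lt_0_compat; lra).
      assert (E := exp_ineq1_le (ln (q / m))); rewrite exp_ln in E; lra. }
    apply (Rmult_le_compat_l m) in H; [|lra].
    replace (m * (q / m - 1)) with (q - m) in H by (field; lra); exact H.
  - unfold Rdiv; rewrite ln_mult, !ln_Rinv; auto; [ring|apply Rinv_0_lt_compat; lra].
Qed.

(** Sum [ln t <= t - 1] at [t = q / m], weighted by [m]; both laws have total mass one over the same
    range, so the right-hand side sums to zero. *)
Lemma gibbs (l l' : list R) : prob_list l -> length l = length l' ->
  (forall s, (s <= length l)%nat -> 0 < mass l' s) ->
  entropy l <= EF l (fun s => ln (/ mass l' s)).
Proof.
  intros Hl Hn Hpos; unfold entropy.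
  rewrite (EF_mass l), (EF_mass l (fun s => ln (/ mass l' s))).
  assert (H : sum_f_R0 (fun s => mass l s * ln (/ mass l s) - mass l s * ln (/ mass l' s)) (length l)
    <= sum_f_R0 (fun s => mass l' s - mass l s) (length l)).
  { apply sum_Rle; intros s Hs; apply gibbs_term; [apply mass_ge0|]; auto. }
  rewrite !minus_sum in H.
  rewrite sum_mass in H; rewrite Hn in H at 3; rewrite sum_mass in H; lra.
Qed.

Lemma prob_list_repeat (a : R) (n : nat) : 0 <= a <= 1 -> prob_list (repeat a n).
Proof. intros Ha; apply Forall_forall; intros x Hx; apply repeat_spec in Hx; subst; exact Ha. Qed.

Lemma mass_0_cons a l : mass (a :: l) 0 = (1 - a) * mass l 0.
Proof.
  unfold mass; simpl; rewrite (EF_const l 0); ring.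
Qed.

Lemma mass_S_cons a l s : mass (a :: l) (S s) = (1 - a) * mass l (S s) + a * mass l s.
Proof. reflexivity. Qed.

Lemma mass_overflow l s : (length l < s)%nat -> mass l s = 0.
Proof.
  intros Hs; rewrite <- (EF_const l 0); apply EF_ext; intros n Hn.
  destruct (Nat.eqb_spec s n); [lia|reflexivity].
Qed.

Lemma binom_0 n : Binomial.C n 0 = 1.
Proof.
  unfold Binomial.C; rewrite Nat.sub_0_r; simpl (fact 0); simpl (INR 1).
  field; apply INR_fact_neq_0.
Qed.

Lemma mass_binomial (a : R) (n : nat) : forall s, (s <= n)%nat ->
  mass (repeat a n) s = Binomial.C n s * a ^ s * (1 - a) ^ (n - s).
Proof.
  induction n as [|n IH]; intros s Hs.
  - replace s with O by lia; unfold mass, Binomial.C; simpl; field.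
  - change (repeat a (S n)) with (a :: repeat a n).
    destruct s as [|s].
    + rewrite mass_0_cons, IH, !binom_0, !Nat.sub_0_r by lia; simpl; ring.
    (* The top value is separate: with truncated subtraction [Binomial.C n (S n)] is not zero, so
       Pascal's rule fails there. *)
    + rewrite mass_S_cons; destruct (Nat.eq_dec s n) as [->|Hsn].
      * rewrite mass_overflow by (rewrite repeat_length; lia).
        rewrite IH by lia; unfold Binomial.C; rewrite !Nat.sub_diag; simpl (fact 0).
        simpl pow; simpl (INR 1); field; split; apply INR_fact_neq_0.
      * rewrite !IH, <- pascal by lia.
        replace (n - s)%nat with (S (n - S s)) by lia.
        replace (S n - S s)%nat with (S (n - S s)) by lia; simpl; ring.
Qed.

Lemma binom_pos n s : 0 < Binomial.C n s.
Proof.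
  unfold Binomial.C; apply Rdiv_lt_0_compat; [|apply Rmult_lt_0_compat]; apply INR_fact_lt_0.
Qed.

Lemma ln_binom_S n s : (s < n)%nat ->
  ln (Binomial.C n (S s)) = ln (Binomial.C n s) + (ln (INR (n - s)) - ln (INR (S s))).
Proof.
  intros H.
  assert (P1 : 0 < INR (n - s)) by (apply lt_0_INR; lia).
  assert (P2 : 0 < INR (S s)) by (apply lt_0_INR; lia).
  assert (E : Binomial.C n (S s) * INR (S s) = Binomial.C n s * INR (n - s)).
  { unfold Binomial.C.
    replace (n - s)%nat with (S (n - S s)) by lia; rewrite !fact_simpl, !mult_INR.
    field; repeat split; try apply INR_fact_neq_0; try (apply not_0_INR; lia). }
  apply (f_equal ln) in E; rewrite !ln_mult in E; auto; try apply binom_pos; lra.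
Qed.

Lemma ln_mass_binomial (a : R) (n s : nat) : 0 < a < 1 -> (s <= n)%nat ->
  ln (/ mass (repeat a n) s)
  = - ln (Binomial.C n s) - INR s * ln a - INR (n - s) * ln (1 - a).
Proof.
  intros Ha Hs; rewrite mass_binomial by exact Hs.
  assert (C := binom_pos n s).
  assert (H1 : 0 < a ^ s) by (apply pow_lt; lra).
  assert (H2 : 0 < (1 - a) ^ (n - s)) by (apply pow_lt; lra).
  assert (H3 := Rmult_lt_0_compat _ _ C H1).
  rewrite ln_Rinv by (apply (Rmult_lt_0_compat _ _ H3 H2)).
  rewrite !ln_mult, !ln_pow by (assumption || lra); ring.
Qed.

Lemma mass_binomial_pos a n s : 0 < a < 1 -> (s <= n)%nat -> 0 < mass (repeat a n) s.
Proof.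
  intros Ha Hs; rewrite mass_binomial by exact Hs.
  apply Rmult_lt_0_compat; [apply Rmult_lt_0_compat; [apply binom_pos|]|]; apply pow_lt; lra.
Qed.

(** The terms linear in [s] drop out of the second difference, which becomes [(ln (s+2) - ln (s+1))
    + (ln (n-s) - ln (n-s-1))]. *)
Lemma convex_ln_mass_binomial a n : 0 < a < 1 ->
  convex_upto n (fun s => ln (/ mass (repeat a n) s)).
Proof.
  intros Ha s Hs; rewrite !ln_mass_binomial by (auto; lia).
  rewrite (ln_binom_S n (S s)), (ln_binom_S n s) by lia.
  replace (n - s)%nat with (S (S (n - S (S s)))) by lia.
  replace (n - S s)%nat with (S (n - S (S s))) by lia.
  assert (L : forall m, ln (INR (S m)) <= ln (INR (S (S m)))).
  { intros m; apply ln_le; [apply lt_0_INR; lia|apply le_INR; lia]. }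
  assert (L1 := L s); assert (L2 := L (n - S (S s))%nat).
  rewrite (S_INR (S (n - S (S s)))), (S_INR (n - S (S s))), (S_INR (S s)), (S_INR s) in *; lra.
Qed.

Lemma entropy_le_binomial (l : list R) (a : R) : prob_list l -> 0 < a < 1 ->
  list_sum_R l = a * INR (length l) -> entropy l <= entropy (repeat a (length l)).
Proof.
  intros Hl Ha Hs.
  apply Rle_trans with (EF l (fun s => ln (/ mass (repeat a (length l)) s))).
  - apply gibbs; auto; [rewrite repeat_length; reflexivity|].
    intros; apply mass_binomial_pos; auto.
  - apply EF_convex_le_binomial; auto; [apply convex_ln_mass_binomial; auto|lra].
Qed.

(** * Entropy of the binomial law *)

(** Each of the [n] trials contributes the same partial derivative: the expected jump of [f] caused
    by that trial, averaged over the other [pred n]. *)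
Lemma is_derive_EF_repeat (n : nat) (a : R) : forall f,
  is_derive (fun b => EF (repeat b n) f) a
    (INR n * EF (repeat a (pred n)) (fun s => f (S s) - f s)).
Proof.
  induction n as [|n IH]; intros f.
  - simpl EF; simpl (INR 0); rewrite Rmult_0_l; apply (is_derive_const (f O) a).
  - assert (D1 := IH f); assert (D2 := IH (fun s => f (S s))).
    simpl repeat; simpl EF.
    evar_last.
    + apply (is_derive_plus (fun b => (1 - b) * EF (repeat b n) f)
        (fun b => b * EF (repeat b n) (fun s => f (S s)))).
      * apply (is_derive_mult (fun b => 1 - b) (fun b => EF (repeat b n) f)); [|exact D1|intros; apply Rmult_comm].
        apply (is_derive_minus (fun _ => 1) (fun b => b)); [apply is_derive_const|apply is_derive_id].
      * apply (is_derive_mult (fun b => b) (fun b => EF (repeat b n) (fun s => f (S s)))); [apply is_derive_id|exact D2|intros; apply Rmult_comm].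
    + change (((0 + - (1)) * EF (repeat a n) f
          + (1 - a) * (INR n * EF (repeat a (pred n)) (fun s => f (S s) - f s)))
        + (1 * EF (repeat a n) (fun s => f (S s))
          + a * (INR n * EF (repeat a (pred n)) (fun s => f (S (S s)) - f (S s))))
        = INR (S n) * EF (repeat a n) (fun s => f (S s) - f s)).
      rewrite !EF_minus, S_INR.
      destruct n as [|n]; [simpl; ring|].
      generalize (INR (S n)); intros c; simpl; ring.
Qed.

(** Size biasing: the weight [s] counts the successful trials; conditioning on one of them leaves
    [pred n] free trials. *)
Lemma EF_repeat_size_bias (n : nat) (a : R) : forall g,
  EF (repeat a n) (fun s => INR s * g s)
  = INR n * a * EF (repeat a (pred n)) (fun s => g (S s)).
Proof.
  induction n as [|n IH]; intros g; [simpl; ring|].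
  change (EF (repeat a (S n)) (fun s => INR s * g s)) with
    ((1 - a) * EF (repeat a n) (fun s => INR s * g s)
     + a * EF (repeat a n) (fun s => INR (S s) * g (S s))).
  rewrite (EF_ext _ (fun s => INR (S s) * g (S s)) (fun s => INR s * g (S s) + g (S s)))
    by (intros; rewrite S_INR; ring).
  rewrite EF_plus, IH, (IH (fun s => g (S s))), S_INR.
  destruct n as [|n]; [simpl; ring|]; simpl pred; simpl repeat; simpl EF; ring.
Qed.

Lemma EF_repeat_id (n : nat) (a : R) : EF (repeat a n) INR = INR n * a.
Proof.
  rewrite (EF_ext _ INR (fun s => INR s * 1)) by (intros; ring).
  rewrite (EF_repeat_size_bias n a (fun _ => 1)), EF_const; ring.
Qed.

Lemma EF_flip (l : list R) : forall f,
  EF (map (fun a => 1 - a) l) f = EF l (fun s => f (length l - s)%nat).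
Proof.
  induction l as [|a l IH]; intros f; [reflexivity|].
  simpl map; simpl EF; rewrite IH, (IH (fun s => f (S s))).
  rewrite (EF_ext l (fun n => f (S (length l - n))) (fun n => f (S (length l) - n)%nat)).
  - simpl length.
    rewrite (EF_ext l (fun n => f (length l - n)%nat) (fun n => f (S (length l) - S n)%nat)) by reflexivity.
    simpl; ring.
  - intros n Hn; f_equal; lia.
Qed.

Lemma mass_flip (l : list R) s : (s <= length l)%nat ->
  mass (map (fun a => 1 - a) l) s = mass l (length l - s)%nat.
Proof.
  intros Hs; unfold mass; rewrite EF_flip; apply EF_ext; intros n Hn.
  destruct (Nat.eqb_spec s (length l - n)), (Nat.eqb_spec (length l - s) n); auto; lia.
Qed.

Lemma entropy_flip (l : list R) : entropy (map (fun a => 1 - a) l) = entropy l.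
Proof.
  unfold entropy; rewrite EF_flip; apply EF_ext; intros n Hn.
  rewrite mass_flip by lia; do 3 f_equal; lia.
Qed.

Lemma ln_S_S_minus_le (s : nat) : ln (INR (S (S s))) - ln (INR (S s)) <= / INR (S s).
Proof.
  assert (P : 0 < INR (S s)) by (apply lt_0_INR; lia).
  assert (P' : 0 < / INR (S s)) by (apply Rinv_0_lt_compat; exact P).
  replace (INR (S (S s))) with (INR (S s) * (1 + / INR (S s)))
    by (rewrite (S_INR (S s)); field; lra).
  rewrite ln_mult by lra.
  assert (E := exp_ineq1_le (ln (1 + / INR (S s)))); rewrite exp_ln in E; lra.
Qed.

(* [n a E[1/(S+1)] <= 1] for [S ~ Bin(n-1, a)] bounds the derivative of [E ln(S+1)] by [1/a]. *)
Lemma EF_ln_minus_ln_decr (n : nat) (a b : R) : 0 < a -> a <= b -> b < 1 ->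
  EF (repeat b n) (fun s => ln (INR (S s))) - ln b
  <= EF (repeat a n) (fun s => ln (INR (S s))) - ln a.
Proof.
  intros Ha [Hab|<-] Hb; [|lra].
  destruct (MVT_cor2 (fun x => EF (repeat x n) (fun s => ln (INR (S s))) - ln x)
    (fun x => INR n * EF (repeat x (pred n)) (fun s => ln (INR (S (S s))) - ln (INR (S s))) - / x)
    a b Hab) as [c [E Hc]].
  - intros c Hc; apply is_derive_Reals.
    apply (is_derive_minus (fun x => EF (repeat x n) (fun s => ln (INR (S s)))) ln).
    + apply (is_derive_EF_repeat n c (fun s => ln (INR (S s)))).
    + apply is_derive_ln; lra.
  - assert (D : INR n * EF (repeat c (pred n)) (fun s => ln (INR (S (S s))) - ln (INR (S s))) <= / c).
    { assert (c * / c = 1) by (field; lra).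
      apply Rmult_le_reg_l with c; [lra|]; rewrite H.
      (* Size biasing turns [n c E[1/(S+1)]] into [E[S * (1/S)]], whose integrand is 0 at [S = 0]
         and 1 elsewhere. *)
      apply Rle_trans with (EF (repeat c n) (fun s => INR s * / INR s)).
      - rewrite EF_repeat_size_bias, <- Rmult_assoc, (Rmult_comm c).
        apply Rmult_le_compat_l; [apply Rmult_le_pos; [apply pos_INR|lra]|].
        apply EF_le; [apply prob_list_repeat; lra|]; intros s _; apply ln_S_S_minus_le.
      - rewrite <- (EF_const (repeat c n) 1).
        apply EF_le; [apply prob_list_repeat; lra|]; intros s _.
        destruct s as [|s]; [simpl; lra|]; rewrite Rinv_r; [lra|apply not_0_INR; lia]. }
    assert (0 <= (/ c - INR n * EF (repeat c (pred n)) (fun s => ln (INR (S (S s))) - ln (INR (S s)))) * (b - a))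
      by (apply Rmult_le_pos; lra).
    lra.
Qed.

Lemma entropy_binomial (n : nat) (a : R) : 0 < a < 1 ->
  entropy (repeat a n)
  = - EF (repeat a n) (fun s => ln (Binomial.C n s))
    - INR n * (a * ln a + (1 - a) * ln (1 - a)).
Proof.
  intros Ha; unfold entropy.
  rewrite (EF_ext _ _ (fun s => (-1) * ln (Binomial.C n s)
    + ((ln (1 - a) - ln a) * INR s + - (INR n * ln (1 - a))))).
  - rewrite !EF_plus, !EF_scal, EF_const, EF_repeat_id; ring.
  - intros s Hs; rewrite repeat_length in Hs.
    rewrite ln_mass_binomial, minus_INR by auto; ring.
Qed.

Lemma entropy_binomial_incr (n : nat) (a : R) : 0 < a <= 1 / 2 ->
  entropy (repeat a n) <= entropy (repeat (1 / 2) n).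
Proof.
  intros [Ha Ha2]; destruct Ha2 as [Ha2| ->]; [|lra].
  destruct n as [|n]; [simpl; lra|].
  rewrite !entropy_binomial by lra.
  set (F := fun x => - EF (repeat x (S n)) (fun s => ln (Binomial.C (S n) s))
    - INR (S n) * (x * ln x + (1 - x) * ln (1 - x))).
  change (F a <= F (1 / 2)).
  set (g := fun x => EF (repeat x n) (fun s => ln (INR (S s)))).
  destruct (MVT_cor2 F (fun x => INR (S n) * ((g x - ln x) - (g (1 - x) - ln (1 - x)))) a (1/2) Ha2)
    as [c [E Hc]].
  - intros c Hc; apply is_derive_Reals.
    evar_last.
    + apply (is_derive_minus (fun x => - EF (repeat x (S n)) (fun s => ln (Binomial.C (S n) s)))
        (fun x => INR (S n) * (x * ln x + (1 - x) * ln (1 - x)))).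
      * apply (is_derive_opp (fun x => EF (repeat x (S n)) (fun s => ln (Binomial.C (S n) s)))).
        apply is_derive_EF_repeat.
      * apply (is_derive_scal (fun x => x * ln x + (1 - x) * ln (1 - x)) c (INR (S n)) (ln c - ln (1 - c))).
        auto_derive; [lra|].
        replace (1 + - c) with (1 - c) by ring; field; lra.
    + unfold minus, plus, opp; cbn -[INR EF repeat Binomial.C].
      (* Exchanging successes and failures rewrites [g (1 - c)] under parameter [c], where it
         matches the term [ln (n - s)] in the increment of [ln] of the binomial coefficient. *)
      assert (G : g (1 - c) = EF (repeat c n) (fun s => ln (INR (S n - s)))).
      { unfold g; replace (repeat (1 - c) n) with (map (fun x => 1 - x) (repeat c n)).
        - rewrite EF_flip, repeat_length; apply EF_ext; intros s Hs.
          rewrite repeat_length in Hs; do 2 f_equal; lia.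
        - clear; induction n as [|n IH]; simpl; [|rewrite IH]; reflexivity. }
      rewrite G; unfold g; simpl pred.
      rewrite (EF_ext _ _ (fun s => ln (INR (S n - s)) - ln (INR (S s)))).
      * rewrite EF_minus; ring.
      * intros s Hs; rewrite repeat_length in Hs; rewrite ln_binom_S by lia; ring.
  (* As [c < 1/2], the point [c] lies to the left of [1 - c], and monotonicity gives the sign of the
     derivative. *)
  - assert (D := EF_ln_minus_ln_decr n c (1 - c)); fold (g c) in D; fold (g (1 - c)) in D.
    assert (0 <= INR (S n) * ((g c - ln c) - (g (1 - c) - ln (1 - c))) * (1 / 2 - a)).
    { apply Rmult_le_pos; [apply Rmult_le_pos; [apply pos_INR|]|lra].
      specialize (D ltac:(lra) ltac:(lra) ltac:(lra)); unfold g in *; lra. }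
    lra.
Qed.

(** * Reduction of arbitrary parameters to mean at most one half *)

Lemma mass_le1 (l : list R) (s : nat) : prob_list l -> mass l s <= 1.
Proof.
  intros Hl; rewrite <- (EF_const l 1); apply EF_le; auto; intros n _.
  destruct (Nat.eqb s n); lra.
Qed.

Lemma entropy_ge0 (l : list R) : prob_list l -> 0 <= entropy l.
Proof.
  intros Hl; unfold entropy; rewrite <- (EF_const l 0) at 1.
  apply EF_le; auto; intros s _.
  destruct (mass_ge0 l s Hl) as [H|<-].
  - rewrite ln_Rinv by exact H; assert (ln (mass l s) <= ln 1)
      by (apply ln_le; [exact H|apply mass_le1; exact Hl]); rewrite ln_1 in *; lra.
  - rewrite Rinv_0; unfold ln; destruct (Rlt_dec 0 0) as [H|H];
    [destruct (Rlt_irrefl 0 H)|apply Rle_refl].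
Qed.

Lemma list_sum_R_bounds (l : list R) : prob_list l -> 0 <= list_sum_R l <= INR (length l).
Proof.
  induction 1 as [|a l Ha Hl IH]; [simpl; lra|].
  change (length (a :: l)) with (S (length l)); rewrite S_INR; simpl; lra.
Qed.

Lemma list_sum_R_eq0 (l : list R) : prob_list l -> list_sum_R l = 0 -> l = repeat 0 (length l).
Proof.
  induction 1 as [|a l Ha Hl IH]; intros H; [reflexivity|].
  change (list_sum_R (a :: l)) with (a + list_sum_R l) in H.
  assert (B := list_sum_R_bounds l Hl); simpl; rewrite <- IH by lra; f_equal; lra.
Qed.

Lemma EF_repeat_0 (n : nat) f : EF (repeat 0 n) f = f O.
Proof. revert f; induction n as [|n IH]; intros f; simpl; [|rewrite !IH]; ring. Qed.

Lemma list_sum_R_flip (l : list R) :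
  list_sum_R (map (fun a => 1 - a) l) = INR (length l) - list_sum_R l.
Proof.
  induction l as [|a l IH]; [simpl; ring|].
  change (length (a :: l)) with (S (length l)); rewrite S_INR.
  change (1 - a + list_sum_R (map (fun x => 1 - x) l) = INR (length l) + 1 - (a + list_sum_R l)).
  rewrite IH; ring.
Qed.

(** A mean of zero is treated apart, since the binomial comparison divides by masses that must be
    positive: all parameters are then zero and the entropy vanishes. *)
Lemma entropy_le_half_of_mean_le (l : list R) : prob_list l ->
  list_sum_R l <= INR (length l) / 2 -> entropy l <= entropy (repeat (1 / 2) (length l)).
Proof.
  intros Hl Hm.
  destruct (list_sum_R_bounds l Hl) as [[H0|H0] _].
  - assert (Hn : 0 < INR (length l)) by lra.
    set (a := list_sum_R l / INR (length l)).
    assert (Ea : list_sum_R l = a * INR (length l)) by (unfold a; field; lra).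
    assert (Ha : 0 < a <= 1 / 2).
    { split; [apply Rdiv_lt_0_compat; lra|].
      apply Rmult_le_reg_r with (INR (length l)); lra. }
    eapply Rle_trans; [apply (entropy_le_binomial l a); auto; lra|].
    apply entropy_binomial_incr; exact Ha.
  - rewrite (list_sum_R_eq0 l Hl) at 1 by auto.
    unfold entropy at 1; rewrite EF_repeat_0; unfold mass; rewrite EF_repeat_0; simpl.
    rewrite Rinv_1, ln_1; apply entropy_ge0, prob_list_repeat; lra.
Qed.

(** If the mean exceeds one half, replacing every parameter by its complement reflects the law and
    keeps the entropy. *)
Lemma entropy_le_half (l : list R) : prob_list l ->
  entropy l <= entropy (repeat (1 / 2) (length l)).
Proof.
  intros Hl; destruct (Rle_dec (list_sum_R l) (INR (length l) / 2)) as [H|H].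
  - apply entropy_le_half_of_mean_le; auto.
  - rewrite <- entropy_flip, <- (length_map (fun a => 1 - a) l).
    apply entropy_le_half_of_mean_le.
    + apply Forall_map; eapply Forall_impl; [|exact Hl]; simpl; intros; lra.
    + rewrite list_sum_R_flip, length_map; lra.
Qed.

(** * Wallis integrals and the logarithm *)

Definition wallis (n : nat) : R := RInt (fun x => sin x ^ n) 0 (PI / 2).

Lemma ex_RInt_sin_pow (n : nat) (a b : R) : ex_RInt (fun x => sin x ^ n) a b.
Proof.
  apply (ex_RInt_continuous (V := R_CompleteNormedModule)); intros x _.
  apply (ex_derive_continuous (fun x => sin x ^ n)); auto_derive; auto.
Qed.

(** The combination of integrands is the derivative of [- cos x * sin x ^ (S n)], which vanishes at
    both endpoints. *)
Lemma wallis_rec (n : nat) : INR (S (S n)) * wallis (S (S n)) = INR (S n) * wallis n.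
Proof.
  assert (H : is_RInt (fun x => INR (S (S n)) * sin x ^ (S (S n)) - INR (S n) * sin x ^ n) 0 (PI / 2) 0).
  { evar_last.
    - apply (is_RInt_derive (fun x => - cos x * sin x ^ (S n))).
      + intros x _; auto_derive; [exact I|].
        assert (E := sin2_cos2 x); unfold Rsqr in E.
        change (- (1 * - sin x) * (sin x * sin x ^ n)
          + - cos x * (1 * cos x * (INR (S n) * sin x ^ n))
          = INR (S (S n)) * (sin x * (sin x * sin x ^ n)) - INR (S n) * sin x ^ n).
        rewrite (S_INR (S n)); generalize (INR (S n)) (sin x ^ n); intros c p.
        replace (- cos x * (1 * cos x * (c * p))) with (- (cos x * cos x) * (c * p)) by ring.
        replace (cos x * cos x) with (1 - sin x * sin x) by lra; ring.
      + intros x _; apply (ex_derive_continuous (fun x => INR (S (S n)) * sin x ^ (S (S n)) - INR (S n) * sin x ^ n)).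
        auto_derive; auto.
    - rewrite cos_PI2, sin_0; unfold minus, plus, opp; simpl; ring. }
  assert (E : RInt (fun x => minus (scal (INR (S (S n))) (sin x ^ S (S n))) (scal (INR (S n)) (sin x ^ n))) 0 (PI / 2) = 0)
    by (apply (is_RInt_unique (V := R_CompleteNormedModule)); exact H).
  rewrite (RInt_minus (V := R_CompleteNormedModule)) in E
    by (apply (ex_RInt_scal (V := R_NormedModule)); apply ex_RInt_sin_pow).
  rewrite !(RInt_scal (V := R_CompleteNormedModule)) in E by apply ex_RInt_sin_pow.
  change (INR (S (S n)) * wallis (S (S n)) + - (INR (S n) * wallis n) = 0) in E; lra.
Qed.

Lemma wallis_0 : wallis 0 = PI / 2.
Proof.
  unfold wallis; simpl; rewrite (RInt_const (V := R_CompleteNormedModule)).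
  unfold scal; simpl; unfold mult; simpl; ring.
Qed.

Lemma wallis_1 : wallis 1 = 1.
Proof.
  unfold wallis; apply is_RInt_unique; evar_last.
  - apply (is_RInt_derive (fun x => - cos x)).
    + intros x _; auto_derive; [exact I|simpl; ring].
    + intros x _; apply (ex_derive_continuous (fun x => sin x ^ 1)); auto_derive; auto.
  - rewrite cos_PI2, cos_0; unfold minus, plus, opp; simpl; ring.
Qed.

Lemma wallis_decr (n : nat) : wallis (S n) <= wallis n.
Proof.
  assert (P := PI_RGT_0).
  apply RInt_le; [lra|apply ex_RInt_sin_pow|apply ex_RInt_sin_pow|].
  intros x Hx; assert (S0 : 0 <= sin x) by (apply sin_ge_0; lra).
  assert (S1 := SIN_bound x); assert (S2 : 0 <= sin x ^ n) by (apply pow_le; exact S0).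
  simpl; rewrite <- (Rmult_1_l (sin x ^ n)) at 2; apply Rmult_le_compat_r; lra.
Qed.

Lemma wallis_prod (n : nat) : INR (S n) * wallis n * wallis (S n) = PI / 2.
Proof.
  induction n as [|n IH]; [rewrite wallis_0, wallis_1; simpl; ring|].
  rewrite <- IH; assert (E := wallis_rec n).
  replace (INR (S (S n)) * wallis (S n) * wallis (S (S n)))
    with (wallis (S n) * (INR (S (S n)) * wallis (S (S n)))) by ring.
  rewrite E; ring.
Qed.

Lemma wallis_even (n : nat) : wallis (2 * n) = PI / 2 * Binomial.C (2 * n) n / 4 ^ n.
Proof.
  induction n as [|n IH].
  - simpl; rewrite wallis_0, binom_0; field.
  - replace (2 * S n)%nat with (S (S (2 * n))) by lia.
    assert (E := wallis_rec (2 * n)); rewrite IH in E.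
    assert (P : 0 < INR (S (S (2 * n)))) by (apply lt_0_INR; lia).
    apply Rmult_eq_reg_l with (INR (S (S (2 * n)))); [rewrite E|lra].
    unfold Binomial.C.
    replace (2 * n - n)%nat with n by lia.
    replace (S (S (2 * n)) - S n)%nat with (S n) by lia.
    rewrite !fact_simpl, !mult_INR, !S_INR, mult_INR; simpl (INR 2); simpl pow.
    assert (0 <= INR n) by apply pos_INR.
    field; repeat split; try lra; try apply INR_fact_neq_0; apply pow_nonzero; lra.
Qed.

(** Monotonicity puts the square of [wallis (2 * n)] between its products with the two neighbouring
    integrals, and [wallis_prod] evaluates both. The bounds later fix Stirling's constant. *)
Lemma ln_central_binom_bounds (n : nat) : (1 <= n)%nat ->
  - / 2 * ln (PI * (INR n + / 2)) <= ln (Binomial.C (2 * n) n) - 2 * INR n * ln 2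
  <= - / 2 * ln (PI * INR n).
Proof.
  intros Hn; assert (P := PI_RGT_0).
  assert (N : 0 < INR n) by (apply lt_0_INR; lia).
  assert (C0 := binom_pos (2 * n) n).
  assert (F0 : 0 < 4 ^ n) by (apply pow_lt; lra).
  set (b := Binomial.C (2 * n) n / 4 ^ n).
  assert (B0 : 0 < b) by (apply Rdiv_lt_0_compat; assumption).
  assert (Eb : wallis (2 * n) = PI / 2 * b) by (unfold b; rewrite wallis_even; field; lra).
  assert (L : ln (Binomial.C (2 * n) n) - 2 * INR n * ln 2 = ln b).
  { unfold b, Rdiv; rewrite ln_mult, ln_Rinv, ln_pow by (try lra; apply Rinv_0_lt_compat; lra).
    replace 4 with (2 * 2) by ring; rewrite ln_mult by lra; ring. }
  assert (W0 : 0 < wallis (2 * n)) by (rewrite Eb; apply Rmult_lt_0_compat; lra).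
  assert (H1 := wallis_prod (2 * n)); assert (D1 := wallis_decr (2 * n)).
  assert (D2 := wallis_decr (pred (2 * n))); assert (H2 := wallis_prod (pred (2 * n))).
  replace (S (pred (2 * n))) with (2 * n)%nat in * by lia.
  rewrite S_INR in H1; rewrite mult_INR in H1, H2; simpl (INR 2) in H1, H2.
  assert (U : PI / 2 <= (2 * INR n + 1) * (wallis (2 * n) * wallis (2 * n))).
  { apply Rle_trans with ((2 * INR n + 1) * (wallis (2 * n) * wallis (S (2 * n)))); [lra|].
    apply Rmult_le_compat_l; [lra|]; apply Rmult_le_compat_l; lra. }
  assert (V : (2 * INR n) * (wallis (2 * n) * wallis (2 * n)) <= PI / 2).
  { apply Rle_trans with (2 * INR n * (wallis (pred (2 * n)) * wallis (2 * n))); [|lra].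
    apply Rmult_le_compat_l; [lra|]; apply Rmult_le_compat_r; lra. }
  rewrite Eb in U, V.
  assert (Q1 : 0 < PI * (INR n + / 2)) by (apply Rmult_lt_0_compat; lra).
  assert (Q2 : 0 < PI * INR n) by (apply Rmult_lt_0_compat; lra).
  assert (U' : / (PI * (INR n + / 2)) <= b * b).
  { apply Rmult_le_reg_l with (PI * (PI * (INR n + / 2))); [apply (Rmult_lt_0_compat _ _ P Q1)|].
    replace (PI * (PI * (INR n + / 2)) * / (PI * (INR n + / 2))) with PI by (field; repeat split; lra); lra. }
  assert (V' : b * b <= / (PI * INR n)).
  { apply Rmult_le_reg_l with (PI * (PI * INR n)); [apply (Rmult_lt_0_compat _ _ P Q2)|].
    replace (PI * (PI * INR n) * / (PI * INR n)) with PI by (field; repeat split; lra); lra. }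
  apply ln_le in U'; [|apply Rinv_0_lt_compat; exact Q1].
  apply ln_le in V'; [|apply Rmult_lt_0_compat; exact B0].
  rewrite (ln_mult b b B0 B0), ln_Rinv in U', V' by assumption; rewrite L; lra.
Qed.

(** Degree 7 leaves an error of order [v ^ 8]; multiplied by [k] at [v = z / k], it has the size
    [z^8 / k^7] allowed in the final remainder. *)
Definition ln_taylor (v : R) : R :=
  v - v ^ 2 / 2 + v ^ 3 / 3 - v ^ 4 / 4 + v ^ 5 / 5 - v ^ 6 / 6 + v ^ 7 / 7.

(** By the geometric sum the difference has derivative [- x ^ 7 / (1 + x)], and [1 + c >= 1/2] at
    the mean value point. *)
Lemma ln_taylor_error (v : R) : Rabs v <= / 2 -> Rabs (ln (1 + v) - ln_taylor v) <= 2 * v ^ 8.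
Proof.
  intros Hv; apply Rabs_le_between in Hv.
  set (f := fun x => ln (1 + x) - ln_taylor x).
  destruct (MVT_gen f 0 v (fun x => - x ^ 7 / (1 + x))) as [c [Hc E]].
  - intros x Hx; assert (- / 2 <= x <= / 2)
      by (unfold Rmin, Rmax in Hx; destruct (Rle_dec 0 v); lra).
    unfold f, ln_taylor; auto_derive; [lra|]; field; lra.
  - intros x Hx; assert (- / 2 <= x <= / 2)
      by (unfold Rmin, Rmax in Hx; destruct (Rle_dec 0 v); lra).
    apply continuity_pt_filterlim, (ex_derive_continuous f).
    unfold f, ln_taylor; auto_derive; lra.
  - assert (Hc' : Rabs c <= Rabs v /\ - / 2 <= c <= / 2).
    { unfold Rmin, Rmax in Hc; destruct (Rle_dec 0 v); split; try lra;
        unfold Rabs; destruct (Rcase_abs c), (Rcase_abs v); lra. }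
    replace (f 0) with 0 in E
      by (unfold f, ln_taylor; rewrite Rplus_0_r, ln_1; field).
    change (Rabs (f v) <= 2 * v ^ 8).
    replace (f v) with (- c ^ 7 / (1 + c) * v) by lra.
    unfold Rdiv; rewrite !Rabs_mult, Rabs_Ropp, <- RPow_abs, Rabs_inv.
    rewrite (Rabs_pos_eq (1 + c)) by lra.
    replace (v ^ 8) with (Rabs v ^ 7 * Rabs v).
    + apply Rle_trans with (Rabs v ^ 7 * 2 * Rabs v); [|right; ring].
      apply Rmult_le_compat_r; [apply Rabs_pos|].
      apply Rmult_le_compat; [apply pow_le, Rabs_pos|left; apply Rinv_0_lt_compat; lra| |].
      * apply pow_incr; split; [apply Rabs_pos|apply Hc'].
      * replace 2 with (/ / 2) by field; apply Rinv_le_contravar; lra.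
    + rewrite <- tech_pow_Rmult with (n := 7%nat); rewrite RPow_abs, (Rmult_comm v).
      unfold Rabs; destruct (Rcase_abs v) as [N|N], (Rcase_abs (v ^ 7)) as [M|M]; try ring.
      * exfalso; apply (Rlt_irrefl 0).
        assert (0 < (- v) ^ 7) by (apply pow_lt; lra).
        replace ((- v) ^ 7) with (- v ^ 7) in * by ring; lra.
      * exfalso; assert (0 <= v ^ 7) by (apply pow_le; lra); lra.
Qed.

(** * Stirling's formula *)

Definition stirling_rem (n : nat) : R :=
  ln (INR (fact n)) - (INR n + / 2) * ln (INR n) + INR n - / (12 * INR n).

(** At [v = 1/n] the left side is the increment of [stirling_rem]. The [1/(12 n)] correction cancels
    everything below [v ^ 4], and the right side, about [12 v ^ 4], is chosen because it
    telescopes. *)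
Lemma stirling_step_bound (v : R) : 0 < v <= / 2 ->
  Rabs ((/ v + / 2) * ln (1 + v) - 1 - v / 12 + v / (12 * (1 + v)))
  <= 4 * (v ^ 3 - (v / (1 + v)) ^ 3).
Proof.
  intros Hv.
  assert (He := ln_taylor_error v ltac:(rewrite Rabs_pos_eq; lra)).
  set (e := ln (1 + v) - ln_taylor v) in He.
  assert (V2 : 0 <= v ^ 2 <= / 4) by (split; [apply pow_le; lra|nra]).
  assert (V3 : 0 <= v ^ 3 <= / 8) by (split; [apply pow_le; lra|simpl in *; nra]).
  assert (V4 : 0 < v ^ 4) by (apply pow_lt; lra).
  assert (W : / 2 <= / (1 + v) <= 1).
  { split; [apply Rinv_le_contravar; lra|rewrite <- Rinv_1 at 2; apply Rinv_le_contravar; lra]. }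
  replace (ln (1 + v)) with (ln_taylor v + e) by (unfold e; ring).
  replace ((/ v + / 2) * (ln_taylor v + e) - 1 - v / 12 + v / (12 * (1 + v)))
    with (v ^ 4 * (3 / 40 - v / 15 + 5 / 84 * v ^ 2 + v ^ 3 / 14 - / (1 + v) / 12)
      + (/ v + / 2) * e) by (unfold ln_taylor; field; lra).
  assert (B : Rabs ((/ v + / 2) * e) <= v ^ 4).
  { assert (0 < / v) by (apply Rinv_0_lt_compat; lra).
    rewrite Rabs_mult, (Rabs_pos_eq (/ v + / 2)) by lra.
    apply Rle_trans with ((/ v + / 2) * (2 * v ^ 8)); [apply Rmult_le_compat_l; lra|].
    replace ((/ v + / 2) * (2 * v ^ 8)) with (v ^ 4 * (2 * v ^ 3 + v ^ 2 * v ^ 2)) by (field; lra).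
    rewrite <- (Rmult_1_r (v ^ 4)) at 2; apply Rmult_le_compat_l; [lra|nra]. }
  assert (A : Rabs (v ^ 4 * (3 / 40 - v / 15 + 5 / 84 * v ^ 2 + v ^ 3 / 14 - / (1 + v) / 12)) <= v ^ 4).
  { rewrite Rabs_mult, (Rabs_pos_eq (v ^ 4)) by lra.
    rewrite <- (Rmult_1_r (v ^ 4)) at 2; apply Rmult_le_compat_l; [lra|].
    apply Rabs_le; lra. }
  eapply Rle_trans; [apply Rabs_triang|].
  apply Rle_trans with (2 * v ^ 4); [lra|].
  assert (P3 : 0 < (1 + v) ^ 3) by (apply pow_lt; lra).
  apply Rmult_le_reg_r with ((1 + v) ^ 3); [exact P3|].
  replace (4 * (v ^ 3 - (v / (1 + v)) ^ 3) * (1 + v) ^ 3)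
    with (v ^ 4 * (4 * (3 + 3 * v + v ^ 2))) by (field; lra).
  replace (2 * v ^ 4 * (1 + v) ^ 3) with (v ^ 4 * (2 * (1 + 3 * v + 3 * v ^ 2 + v ^ 3))) by ring.
  apply Rmult_le_compat_l; lra.
Qed.

Lemma stirling_rem_step (n : nat) : (2 <= n)%nat ->
  Rabs (stirling_rem n - stirling_rem (S n)) <= 4 * / INR n ^ 3 - 4 * / INR (S n) ^ 3.
Proof.
  intros Hn.
  assert (N : 2 <= INR n) by (apply le_INR in Hn; simpl in Hn; lra).
  assert (V : 0 < / INR n <= / 2)
    by (split; [apply Rinv_0_lt_compat|apply Rinv_le_contravar]; lra).
  assert (H := stirling_step_bound (/ INR n) V).
  assert (E : stirling_rem n - stirling_rem (S n) =
    (/ / INR n + / 2) * ln (1 + / INR n) - 1 - / INR n / 12 + / INR n / (12 * (1 + / INR n))).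
  { unfold stirling_rem; rewrite fact_simpl, mult_INR, ln_mult
      by (apply INR_fact_lt_0 || (apply lt_0_INR; lia)).
    replace (1 + / INR n) with (INR (S n) * / INR n) by (rewrite S_INR; field; lra).
    rewrite ln_mult, ln_Rinv by (lra || (apply lt_0_INR; lia)).
    rewrite Rinv_inv, !S_INR; field; repeat split; lra. }
  rewrite E; eapply Rle_trans; [exact H|].
  rewrite S_INR; right; field; repeat split; lra.
Qed.

(** With [t = 4 / n^3], the step bound makes [stirling_rem - t] increasing and [stirling_rem + t]
    decreasing; the limit of the former lies between them. The shift by 2 is where the step bound
    starts. *)
Lemma stirling_rem_lim : exists c, forall n, (2 <= n)%nat ->
  Rabs (stirling_rem n - c) <= 4 * / INR n ^ 3.
Proof.
  set (t := fun n : nat => 4 * / INR (n + 2) ^ 3).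
  set (u := fun n => stirling_rem (n + 2) - t n).
  set (w := fun n => stirling_rem (n + 2) + t n).
  assert (St : forall n, u n <= u (S n) /\ w (S n) <= w n).
  { intros n; assert (H := stirling_rem_step (n + 2) ltac:(lia)).
    apply Rabs_le_between in H; unfold u, w, t.
    replace (S n + 2)%nat with (S (n + 2)) by lia; lra. }
  assert (T : forall n, 0 <= t n).
  { intros n; unfold t; apply Rmult_le_pos; [lra|]; left.
    apply Rinv_0_lt_compat, pow_lt, lt_0_INR; lia. }
  assert (Wd : forall n, w n <= w O).
  { induction n as [|n IH]; [lra|]; destruct (St n); lra. }
  destruct (ex_finite_lim_seq_incr u (w O)) as [c Hc].
  { intros n; apply St. }
  { intros n; specialize (Wd n); specialize (T n); unfold u, w in *; lra. }
  assert (Hu := is_lim_seq_incr_compare u c Hc (fun n => proj1 (St n))).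
  assert (Hw : forall n, c <= w n).
  { intros n; apply Rnot_lt_le; intros Hlt.
    assert (A : forall m, (n <= m)%nat -> w m <= w n).
    { induction 1 as [|m _ IH]; [lra|]; destruct (St m); lra. }
    assert (L := is_lim_seq_le_loc u (fun _ => w n) c (w n)).
    simpl in L; apply (Rlt_not_le _ _ Hlt), L; [|exact Hc|apply is_lim_seq_const].
    exists n; intros m Hm; specialize (A m Hm); specialize (T m); unfold u, w in *; lra. }
  exists c; intros n Hn; specialize (Hu (n - 2)%nat); specialize (Hw (n - 2)%nat).
  unfold u, w, t in *; replace (n - 2 + 2)%nat with n in * by lia.
  apply Rabs_le; lra.
Qed.

Lemma eq_of_le_div (x y M : R) :
  (forall n, (2 <= n)%nat -> Rabs (x - y) <= M * / INR n) -> x = y.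
Proof.
  intros H; destruct (Req_dec x y) as [E|E]; [exact E|exfalso].
  assert (P : 0 < Rabs (x - y)) by (apply Rabs_pos_lt; lra).
  destruct (INR_archimed (Rabs (x - y)) M P) as [n Hn].
  specialize (H (n + 2)%nat ltac:(lia)).
  assert (N : 0 < INR (n + 2)) by (apply lt_0_INR; lia).
  apply (Rmult_le_compat_r (INR (n + 2))) in H; [|lra].
  rewrite Rmult_assoc, Rinv_l, plus_INR in H by lra; simpl in H; lra.
Qed.

(** The limit [c] is identified by comparing the remainders at [m] and [2 * m] with the central
    binomial bounds, up to [O(1/m)]. *)
Lemma stirling (n : nat) : (2 <= n)%nat ->
  Rabs (ln (INR (fact n))
    - ((INR n + / 2) * ln (INR n) - INR n + / 2 * ln (2 * PI) + / (12 * INR n)))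
  <= 4 * / INR n ^ 3.
Proof.
  destruct stirling_rem_lim as [c Hc].
  assert (P := PI_RGT_0).
  assert (Ec : c = / 2 * ln (2 * PI)); [|rewrite <- Ec; intros Hn; specialize (Hc n Hn);
    unfold stirling_rem in Hc;
    match goal with |- Rabs ?x <= _ => match type of Hc with Rabs ?y <= _ =>
      replace x with y by ring end end; exact Hc].
  (* The cubic errors, weakened to multiples of [1/m], give 8 from two uses at [m] and 2 from
     [2 * m]; the rest is below 3. *)
  apply (eq_of_le_div _ _ 13); intros m Hm.
  assert (N : 2 <= INR m) by (apply le_INR in Hm; simpl in Hm; lra).
  assert (A := Hc m Hm); assert (B := Hc (2 * m)%nat ltac:(lia)).
  assert (W := ln_central_binom_bounds m ltac:(lia)).
  unfold Binomial.C in W; replace (2 * m - m)%nat with m in W by lia.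
  unfold Rdiv in W.
  assert (F1 := INR_fact_lt_0 m); assert (F2 := INR_fact_lt_0 (2 * m)).
  rewrite (ln_mult (INR (fact (2 * m)))), ln_Rinv, (ln_mult (INR (fact m))), (ln_mult PI), (ln_mult PI) in W
    by (try lra; try apply Rinv_0_lt_compat; apply Rmult_lt_0_compat; lra).
  assert (I0 : 0 < / INR m) by (apply Rinv_0_lt_compat; lra).
  assert (LH : ln (INR m + / 2) <= ln (INR m) + / 2 * / INR m).
  { replace (INR m + / 2) with (INR m * (1 + / 2 * / INR m)) by (field; lra).
    rewrite ln_mult by lra.
    assert (E := exp_ineq1_le (ln (1 + / 2 * / INR m))); rewrite exp_ln in E; lra. }
  assert (T : forall x, 2 <= x -> / x ^ 3 <= / x).
  { intros x Hx; apply Rinv_le_contravar; [lra|].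
    assert (1 <= x * x) by nra; simpl; nra. }
  assert (T1 := T _ N); assert (M2 : INR (2 * m) = 2 * INR m) by (rewrite mult_INR; simpl; ring).
  assert (T2 := T (INR (2 * m)) ltac:(lra)).
  assert (I2 : / (2 * INR m) = / 2 * / INR m) by (field; lra).
  apply Rabs_le_between in A; apply Rabs_le_between in B.
  unfold stirling_rem in A, B; rewrite M2, (ln_mult 2) in B by lra.
  rewrite M2, I2 in T2.
  replace (/ (12 * INR m)) with (/ 12 * / INR m) in A by (field; lra).
  replace (/ (12 * (2 * INR m))) with (/ 24 * / INR m) in B by (field; lra).
  rewrite (ln_mult 2) by lra.
  apply Rabs_le.
  generalize dependent (/ INR m); intros i; intros.
  generalize dependent (/ INR m ^ 3); intros i3; intros.
  generalize dependent (/ (2 * INR m) ^ 3); intros j3; intros.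
  split; lra.
Qed.

(** * Moments of a sum of signs *)

(* For [S ~ Bin(k, 1/2)], [2 S - k] is a sum of [k] independent uniform signs. *)
Definition Esign (k : nat) (f : R -> R) : R :=
  EF (repeat (1 / 2) k) (fun s => f (2 * INR s - INR k)).

Lemma Esign_ext k f g : (forall z, f z = g z) -> Esign k f = Esign k g.
Proof. intros H; apply EF_ext; intros; apply H. Qed.

Lemma Esign_plus k f g : Esign k (fun z => f z + g z) = Esign k f + Esign k g.
Proof. apply EF_plus. Qed.

Lemma Esign_scal k c f : Esign k (fun z => c * f z) = c * Esign k f.
Proof. apply EF_scal. Qed.

Lemma Esign_const k c : Esign k (fun _ => c) = c.
Proof. unfold Esign; apply EF_const. Qed.

Lemma Esign_S k f : Esign (S k) f = Esign k (fun z => / 2 * f (z - 1) + / 2 * f (z + 1)).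
Proof.
  rewrite Esign_plus, !Esign_scal; unfold Esign; simpl repeat; cbn [EF].
  replace (1 - 1 / 2) with (/ 2) by field; replace (1 / 2 * EF _ _) with
    (/ 2 * EF (repeat (1 / 2) k) (fun n => f (2 * INR (S n) - INR (S k)))) by field.
  f_equal; f_equal; apply EF_ext; intros s _; f_equal; rewrite !S_INR; ring.
Qed.

(** Degree 12 accommodates the square of the degree 6 main term. *)
Definition even_poly (c0 c1 c2 c3 c4 c5 c6 z : R) : R :=
  c0 + c1 * z ^ 2 + c2 * z ^ 4 + c3 * z ^ 6 + c4 * z ^ 8 + c5 * z ^ 10 + c6 * z ^ 12.

Lemma Esign_even_poly_moments k c0 c1 c2 c3 c4 c5 c6 :
  Esign k (even_poly c0 c1 c2 c3 c4 c5 c6)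
  = c0 + c1 * Esign k (fun z => z ^ 2) + c2 * Esign k (fun z => z ^ 4)
    + c3 * Esign k (fun z => z ^ 6) + c4 * Esign k (fun z => z ^ 8)
    + c5 * Esign k (fun z => z ^ 10) + c6 * Esign k (fun z => z ^ 12).
Proof. unfold even_poly; rewrite !Esign_plus, !Esign_scal, Esign_const; reflexivity. Qed.

(** The arguments are the coefficients of [((z - 1)^m + (z + 1)^m) / 2] in powers of [z^2]: the
    binomial coefficients of [m] at even indices. *)
Ltac sign_moment_step c0 c1 c2 c3 c4 c5 c6 :=
  rewrite Esign_S, (Esign_ext _ _ (even_poly c0 c1 c2 c3 c4 c5 c6))
    by (intros; unfold even_poly; field);
  rewrite Esign_even_poly_moments.

Lemma sign_moment_0 m : Esign 0 (fun z => z ^ S m) = 0.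
Proof. unfold Esign; simpl; ring. Qed.

Lemma sign_moment_2 k : Esign k (fun z => z ^ 2) = INR k.
Proof.
  induction k as [|k IH]; [apply sign_moment_0|].
  sign_moment_step 1 1 0 0 0 0 0; rewrite IH, S_INR; ring.
Qed.

Lemma sign_moment_4 k : Esign k (fun z => z ^ 4) = 3 * INR k ^ 2 - 2 * INR k.
Proof.
  induction k as [|k IH]; [rewrite sign_moment_0; simpl; ring|].
  sign_moment_step 1 6 1 0 0 0 0; rewrite IH, sign_moment_2, S_INR; ring.
Qed.

Lemma sign_moment_6 k :
  Esign k (fun z => z ^ 6) = 15 * INR k ^ 3 - 30 * INR k ^ 2 + 16 * INR k.
Proof.
  induction k as [|k IH]; [rewrite sign_moment_0; simpl; ring|].
  sign_moment_step 1 15 15 1 0 0 0.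
  rewrite IH, sign_moment_4, sign_moment_2, S_INR; ring.
Qed.

Lemma sign_moment_8 k :
  Esign k (fun z => z ^ 8)
  = 105 * INR k ^ 4 - 420 * INR k ^ 3 + 588 * INR k ^ 2 - 272 * INR k.
Proof.
  induction k as [|k IH]; [rewrite sign_moment_0; simpl; ring|].
  sign_moment_step 1 28 70 28 1 0 0.
  rewrite IH, sign_moment_6, sign_moment_4, sign_moment_2, S_INR; ring.
Qed.

Lemma sign_moment_10 k :
  Esign k (fun z => z ^ 10)
  = 945 * INR k ^ 5 - 6300 * INR k ^ 4 + 16380 * INR k ^ 3 - 18960 * INR k ^ 2 + 7936 * INR k.
Proof.
  induction k as [|k IH]; [rewrite sign_moment_0; simpl; ring|].
  sign_moment_step 1 45 210 210 45 1 0.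
  rewrite IH, sign_moment_8, sign_moment_6, sign_moment_4, sign_moment_2, S_INR; ring.
Qed.

Lemma sign_moment_12 k :
  Esign k (fun z => z ^ 12)
  = 10395 * INR k ^ 6 - 103950 * INR k ^ 5 + 429660 * INR k ^ 4 - 893640 * INR k ^ 3
    + 911328 * INR k ^ 2 - 353792 * INR k.
Proof.
  induction k as [|k IH]; [rewrite sign_moment_0; simpl; ring|].
  sign_moment_step 1 66 495 924 495 66 1.
  rewrite IH, sign_moment_10, sign_moment_8, sign_moment_6, sign_moment_4, sign_moment_2, S_INR; ring.
Qed.

Lemma Esign_even_poly k c0 c1 c2 c3 c4 c5 c6 f :
  (forall z, f z = even_poly c0 c1 c2 c3 c4 c5 c6 z) ->
  let x := INR k in
  Esign k f = c0 + c1 * x + c2 * (3 * x ^ 2 - 2 * x)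
    + c3 * (15 * x ^ 3 - 30 * x ^ 2 + 16 * x)
    + c4 * (105 * x ^ 4 - 420 * x ^ 3 + 588 * x ^ 2 - 272 * x)
    + c5 * (945 * x ^ 5 - 6300 * x ^ 4 + 16380 * x ^ 3 - 18960 * x ^ 2 + 7936 * x)
    + c6 * (10395 * x ^ 6 - 103950 * x ^ 5 + 429660 * x ^ 4 - 893640 * x ^ 3
            + 911328 * x ^ 2 - 353792 * x).
Proof.
  intros H x; rewrite (Esign_ext k f _ H), Esign_even_poly_moments, sign_moment_12,
    sign_moment_10, sign_moment_8, sign_moment_6, sign_moment_4, sign_moment_2; reflexivity.
Qed.

(* With [w = 1/k], [main_term w z] is the expansion of
   [- ln P(S = s) - ln (pi k / 2) / 2] at [z = 2 s - k], where [z] has order [sqrt k]. *)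
Definition main_term (w z : R) : R :=
  w / 4 + (w / 2 - w ^ 2 / 2 + w ^ 3 / 3) * z ^ 2
  + (w ^ 3 / 12 - w ^ 4 / 4) * z ^ 4 + w ^ 5 / 30 * z ^ 6.

(** Every summand has order [k^-3] when [z] has order [sqrt k]. *)
Definition error_term (w z : R) : R :=
  w ^ 3 + w ^ 5 * z ^ 4 + w ^ 6 * z ^ 6 + w ^ 7 * z ^ 8.

(** The [1 / 2] later becomes the factor [e] inside the logarithm, and [w ^ 2 / 12] is the
    correction in the mutual information. *)
Lemma Esign_main_term k : (1 <= k)%nat -> let w := / INR k in
  Esign k (main_term w) = 1 / 2 - w ^ 2 / 12 - w ^ 3 / 2 + 8 / 15 * w ^ 4.
Proof.
  intros Hk w; assert (K : INR k <> 0) by (apply not_0_INR; lia).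
  rewrite (Esign_even_poly k (w / 4) (w / 2 - w ^ 2 / 2 + w ^ 3 / 3)
    (w ^ 3 / 12 - w ^ 4 / 4) (w ^ 5 / 30) 0 0 0) by (intros; unfold main_term, even_poly; ring).
  unfold w; field; exact K.
Qed.

(** Subtracting the square of [1/2 - w^2/12] leaves [1/2 - w/2 - w^2/2] up to order [w^3], the part
    of the dispersion bracket free of [delta]. *)
Lemma Esign_main_term_sqr k : (1 <= k)%nat -> let w := / INR k in
  Esign k (fun z => main_term w z ^ 2)
  = 3 / 4 - w / 2 - 7 / 12 * w ^ 2 - 35 / 6 * w ^ 3 + 2071 / 240 * w ^ 4 - 37 / 180 * w ^ 5
    + 9997 / 60 * w ^ 6 - 5903 / 9 * w ^ 7 + 22008 / 25 * w ^ 8 - 88448 / 225 * w ^ 9.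
Proof.
  intros Hk w; assert (K : INR k <> 0) by (apply not_0_INR; lia).
  set (a1 := w / 2 - w ^ 2 / 2 + w ^ 3 / 3); set (a2 := w ^ 3 / 12 - w ^ 4 / 4).
  rewrite (Esign_even_poly k ((w / 4) ^ 2) (w / 2 * a1) (a1 ^ 2 + w / 2 * a2)
    (w / 2 * (w ^ 5 / 30) + 2 * a1 * a2) (a2 ^ 2 + 2 * a1 * (w ^ 5 / 30))
    (2 * a2 * (w ^ 5 / 30)) ((w ^ 5 / 30) ^ 2))
    by (intros; unfold main_term, even_poly; fold a1; fold a2; field).
  unfold a1, a2, w; field; exact K.
Qed.

Lemma pow_le_cube (w : R) (n : nat) : 0 <= w <= 1 -> 0 <= w ^ (3 + n) <= w ^ 3.
Proof.
  intros Hw; assert (H : 0 <= w ^ n <= 1)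
    by (split; [apply pow_le; lra|rewrite <- (pow1 n); apply pow_incr; lra]).
  assert (0 <= w ^ 3) by (apply pow_le; lra); rewrite pow_add; split; nra.
Qed.

(** The weight [3 * (w * z ^ 2) + 1] dominates 1, [main_term] and [error_term] on the support, so
    one bound serves both moments. The positive coefficients of the exact value add up to 78686. *)
Lemma Esign_error_term k : (1 <= k)%nat -> let w := / INR k in
  Esign k (fun z => error_term w z * (3 * (w * z ^ 2) + 1)) <= 80000 * w ^ 3.
Proof.
  intros Hk w; assert (K : INR k <> 0) by (apply not_0_INR; lia).
  assert (Hw : 0 <= w <= 1).
  { unfold w; apply le_INR in Hk; simpl in Hk; split;
      [left; apply Rinv_0_lt_compat; lra|rewrite <- Rinv_1; apply Rinv_le_contravar; lra]. }
  rewrite (Esign_even_poly k (w ^ 3) (3 * w ^ 4) (w ^ 5) (w ^ 6 + 3 * w ^ 6) (w ^ 7 + 3 * w ^ 7)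
    (3 * w ^ 8) 0) by (intros; unfold error_term, even_poly; ring).
  match goal with |- ?A <= _ => replace A with
    (3322 * w ^ 3 - 20702 * w ^ 4 + 51556 * w ^ 5 - 57968 * w ^ 6 + 23808 * w ^ 7)
    by (unfold w; field; exact K) end.
  assert (H1 := pow_le_cube w 1 Hw); assert (H2 := pow_le_cube w 2 Hw).
  assert (H3 := pow_le_cube w 3 Hw); assert (H4 := pow_le_cube w 4 Hw).
  cbn [Nat.add] in *; lra.
Qed.

(** Each attainable sum comes from at least one of the [2 ^ n] equally likely sequences; this crude
    bound suffices far from the centre. *)
Lemma mass_half_ge (n : nat) : forall s, (s <= n)%nat -> / 2 ^ n <= mass (repeat (1 / 2) n) s.
Proof.
  induction n as [|n IH]; intros s Hs.
  - replace s with O by lia; unfold mass; simpl; rewrite Rinv_1; lra.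
  - assert (E : / 2 ^ S n = 1 / 2 * / 2 ^ n)
      by (simpl; field; apply pow_nonzero; lra).
    rewrite E; change (repeat (1 / 2) (S n)) with (1 / 2 :: repeat (1 / 2) n).
    destruct s as [|s]; [rewrite mass_0_cons; specialize (IH O ltac:(lia)); lra|].
    rewrite mass_S_cons; specialize (IH s ltac:(lia)).
    assert (0 <= mass (repeat (1 / 2) n) (S s)) by (apply mass_ge0, prob_list_repeat; lra); lra.
Qed.

(** * Expansion of the binomial mass function *)

Lemma even_pow_ge0 (u : R) (n : nat) : 0 <= u ^ (2 * n).
Proof. rewrite pow_mult; apply pow_le, pow2_ge_0. Qed.

(** This is what Stirling's formula leaves at [x (1 + u) / 2] and [x (1 - u) / 2]. The entropy-like
    part leaves [x u^8], the half logarithms [u^6], the reciprocals [u^4 / x]; the odd powers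
    cancel. *)
Lemma main_term_expansion (x u : R) : 1 <= x -> Rabs u <= / 2 ->
  Rabs (x / 2 * ((1 + u) * ln (1 + u) + (1 - u) * ln (1 - u)) + / 2 * (ln (1 + u) + ln (1 - u))
    + (/ (6 * x * (1 + u)) + / (6 * x * (1 - u)) - / (12 * x)) - main_term (/ x) (x * u))
  <= 5 * (u ^ 4 / x + u ^ 6 + x * u ^ 8).
Proof.
  intros Hx Hu.
  assert (He1 := ln_taylor_error u Hu).
  assert (He2 := ln_taylor_error (- u) ltac:(rewrite Rabs_Ropp; exact Hu)).
  apply Rabs_le_between in Hu.
  replace (1 + - u) with (1 - u) in He2 by ring.
  replace ((- u) ^ 8) with (u ^ 8) in He2 by ring.
  set (e1 := ln (1 + u) - ln_taylor u) in He1.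
  set (e2 := ln (1 - u) - ln_taylor (- u)) in He2.
  replace (ln (1 + u)) with (ln_taylor u + e1) by (unfold e1; ring).
  replace (ln (1 - u)) with (ln_taylor (- u) + e2) by (unfold e2; ring).
  assert (U2 : u ^ 2 <= / 4) by nra.
  assert (U4 := even_pow_ge0 u 2); assert (U6 := even_pow_ge0 u 3); assert (U8 := even_pow_ge0 u 4).
  cbn [Nat.mul Nat.add] in U4, U6, U8.
  assert (X0 : 0 < / x) by (apply Rinv_0_lt_compat; lra).
  assert (Q : 0 < / (1 - u ^ 2) <= 4 / 3).
  { split; [apply Rinv_0_lt_compat; lra|].
    replace (4 / 3) with (/ (3 / 4)) by field; apply Rinv_le_contravar; lra. }
  match goal with |- Rabs ?A <= _ => replace A with
    (x * u ^ 8 / 7 - u ^ 6 / 6 + u ^ 4 / x * / (1 - u ^ 2) / 3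
     + (x / 2 * ((1 + u) * e1 + (1 - u) * e2) + / 2 * (e1 + e2)))
    by (unfold ln_taylor, main_term; field; repeat split; nra) end.
  assert (Y4 : 0 <= u ^ 4 / x) by (apply Rmult_le_pos; lra).
  assert (Y8 : u ^ 8 <= x * u ^ 8) by nra.
  assert (Z4 : 0 <= u ^ 4 / x * / (1 - u ^ 2) / 3 <= u ^ 4 / x).
  { split; [|nra]; apply Rmult_le_pos; [apply Rmult_le_pos|]; lra. }
  apply Rabs_le_between in He1; apply Rabs_le_between in He2.
  assert (B : Rabs ((1 + u) * e1 + (1 - u) * e2) <= 4 * u ^ 8) by (apply Rabs_le; split; nra).
  apply Rabs_le_between in B.
  assert (B' : Rabs (x / 2 * ((1 + u) * e1 + (1 - u) * e2)) <= 2 * (x * u ^ 8)).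
  { apply Rabs_le; split; nra. }
  apply Rabs_le_between in B'.
  apply Rabs_le; split; lra.
Qed.

Definition self_info (k s : nat) : R := ln (/ mass (repeat (1 / 2) k) s).

Lemma self_info_fact (k s : nat) : (s <= k)%nat ->
  self_info k s = INR k * ln 2 - ln (INR (fact k)) + ln (INR (fact s)) + ln (INR (fact (k - s))).
Proof.
  intros Hs; unfold self_info; rewrite ln_mass_binomial by (lra || exact Hs).
  replace (1 - 1 / 2) with (/ 2) by field; replace (1 / 2) with (/ 2) by field.
  assert (F1 := INR_fact_lt_0 k); assert (F2 := INR_fact_lt_0 s); assert (F3 := INR_fact_lt_0 (k - s)).
  unfold Binomial.C, Rdiv.
  assert (F4 := Rmult_lt_0_compat _ _ F2 F3).
  rewrite (ln_mult (INR (fact k))) by (assumption || (apply Rinv_0_lt_compat; assumption)).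
  rewrite !ln_Rinv by (assumption || lra).
  rewrite (ln_mult (INR (fact s))), minus_INR by assumption; ring.
Qed.

(** The restriction on [z] keeps [s] and [k - s] at least [k / 4], hence at least 2 for [k >= 8], so
    Stirling's formula applies to all three factorials. *)
Lemma self_info_center (k s : nat) : (8 <= k)%nat -> (s <= k)%nat ->
  Rabs (2 * INR s - INR k) <= INR k / 2 ->
  Rabs (self_info k s - / 2 * ln (PI * INR k / 2) - main_term (/ INR k) (2 * INR s - INR k))
  <= 600 * error_term (/ INR k) (2 * INR s - INR k).
Proof.
  intros Hk Hs Hz.
  assert (P := PI_RGT_0).
  set (x := INR k) in *.
  assert (X : 8 <= x) by (apply le_INR in Hk; simpl in Hk; unfold x; lra).
  set (u := (2 * INR s - x) / x).
  assert (Ez : 2 * INR s - x = x * u) by (unfold u; field; lra).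
  assert (Es : INR s = x * (1 + u) / 2) by (unfold u; field; lra).
  assert (Et : INR (k - s) = x * (1 - u) / 2)
    by (rewrite minus_INR by exact Hs; fold x; unfold u; field; lra).
  assert (Hu : Rabs u <= / 2).
  { rewrite Ez, Rabs_mult, (Rabs_pos_eq x) in Hz by lra.
    apply Rmult_le_reg_l with x; lra. }
  assert (M := main_term_expansion x u ltac:(lra) Hu).
  apply Rabs_le_between in Hu.
  rewrite self_info_fact, Ez by exact Hs; fold x.
  assert (S2 : (2 <= s)%nat) by (apply INR_le; simpl; nra).
  assert (T2 : (2 <= k - s)%nat) by (apply INR_le; simpl; nra).
  assert (B1 := stirling k ltac:(lia)); assert (B2 := stirling s S2); assert (B3 := stirling (k - s) T2).
  (* The Stirling errors thus add up to at most [(4 + 256 + 256) / x^3], within the factor 600. *)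
  assert (C3 : forall y, x / 4 <= y -> / y ^ 3 <= 64 * / x ^ 3).
  { intros y Hy; replace (64 * / x ^ 3) with (/ (x / 4) ^ 3) by (field; lra).
    apply Rinv_le_contravar; [apply pow_lt; lra|apply pow_incr; lra]. }
  assert (D2 := C3 (INR s) ltac:(nra)); assert (D3 := C3 (INR (k - s)) ltac:(nra)).
  fold x in B1; set (x3 := / x ^ 3) in *.
  rewrite Es in B2 at 1 2 3 4; rewrite Et in B3 at 1 2 3 4.
  assert (L1 : ln (x * (1 + u) / 2) = ln x + ln (1 + u) - ln 2).
  { unfold Rdiv; rewrite !ln_mult, ln_Rinv by (try lra; apply Rmult_lt_0_compat; lra); ring. }
  assert (L2 : ln (x * (1 - u) / 2) = ln x + ln (1 - u) - ln 2).
  { unfold Rdiv; rewrite !ln_mult, ln_Rinv by (try lra; apply Rmult_lt_0_compat; lra); ring. }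
  assert (L3 : ln (PI * x / 2) = ln PI + ln x - ln 2).
  { assert (0 < PI * x) by (apply Rmult_lt_0_compat; lra).
    unfold Rdiv; rewrite (ln_mult (PI * x)), (ln_mult PI), ln_Rinv by lra; ring. }
  rewrite L3.
  set (F0 := ln (INR (fact k))) in *; set (F1 := ln (INR (fact s))) in *;
    set (F2 := ln (INR (fact (k - s)))) in *.
  rewrite L1, (ln_mult 2) in B2 by lra; rewrite L2, (ln_mult 2) in B3 by lra; rewrite (ln_mult 2) in B1 by lra.
  match type of B1 with Rabs ?A <= _ => set (E1 := A) in B1 end.
  match type of B2 with Rabs ?A <= _ => set (E2 := A) in B2 end.
  match type of B3 with Rabs ?A <= _ => set (E3 := A) in B3 end.
  match type of M with Rabs ?A <= _ => set (E0 := A) in M end.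
  (* All leading terms cancel exactly: only the expansion error [E0] and the Stirling errors at [k],
     [s] and [k - s] remain. *)
  replace (x * ln 2 - F0 + F1 + F2 - / 2 * (ln PI + ln x - ln 2) - main_term (/ x) (x * u))
    with (E0 + E2 + E3 - E1)
    by (unfold E0, E1, E2, E3; field; repeat split; lra).
  assert (G : error_term (/ x) (x * u) = x3 + (u ^ 4 / x + u ^ 6 + x * u ^ 8))
    by (unfold error_term, x3; field; lra).
  rewrite G.
  assert (U4 := even_pow_ge0 u 2); assert (U6 := even_pow_ge0 u 3); assert (U8 := even_pow_ge0 u 4).
  cbn [Nat.mul Nat.add] in U4, U6, U8.
  assert (Y4 : 0 <= u ^ 4 / x) by (apply Rmult_le_pos; [lra|left; apply Rinv_0_lt_compat; lra]).
  assert (Y8 : 0 <= x * u ^ 8) by nra.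
  assert (X3 : 0 < x3) by (apply Rinv_0_lt_compat, pow_lt; lra).
  apply Rabs_le_between in B1; apply Rabs_le_between in B2; apply Rabs_le_between in B3.
  apply Rabs_le_between in M.
  apply Rabs_le; split; lra.
Qed.

Lemma scaled_pow_le (w z : R) (n : nat) : 0 <= w -> (w * z) ^ 2 <= 1 ->
  0 <= w ^ (2 * n + 1) * z ^ (2 * n + 2) <= w * z ^ 2.
Proof.
  intros Hw Hz.
  assert (E : w ^ (2 * n + 1) * z ^ (2 * n + 2) = w * z ^ 2 * ((w * z) ^ 2) ^ n).
  { rewrite <- pow_mult, Rpow_mult_distr, !pow_add; ring. }
  assert (H : 0 <= ((w * z) ^ 2) ^ n <= 1).
  { split; [apply pow_le, pow2_ge_0|rewrite <- (pow1 n); apply pow_incr; split;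
      [apply pow2_ge_0|exact Hz]]. }
  assert (0 <= w * z ^ 2) by (apply Rmult_le_pos; [exact Hw|apply pow2_ge_0]).
  rewrite E; split; nra.
Qed.

(** When [|w z| <= 1], each monomial is at most [w * z ^ 2], up to a bounded factor or the additive
    constant. *)
Lemma main_error_term_bounds (w z : R) : 0 <= w <= 1 -> (w * z) ^ 2 <= 1 ->
  Rabs (main_term w z) <= 3 * (w * z ^ 2) + 1 /\
  0 <= error_term w z <= 3 * (w * z ^ 2) + 1.
Proof.
  intros Hw Hz.
  assert (H0 : 0 <= w * z ^ 2) by (apply Rmult_le_pos; [lra|apply pow2_ge_0]).
  assert (H1 := scaled_pow_le w z 1 (proj1 Hw) Hz).
  assert (H2 := scaled_pow_le w z 2 (proj1 Hw) Hz).
  assert (H3 := scaled_pow_le w z 3 (proj1 Hw) Hz).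
  cbn [Nat.mul Nat.add] in H1, H2, H3.
  assert (W2 : 0 <= w ^ 2 <= 1) by (split; [apply pow_le; lra|nra]).
  assert (W3 := pow_le_cube w 0 Hw); cbn [Nat.add] in W3.
  assert (W31 : w ^ 3 <= 1) by (replace (w ^ 3) with (w * w ^ 2) by ring; nra).
  unfold main_term, error_term.
  replace ((w / 2 - w ^ 2 / 2 + w ^ 3 / 3) * z ^ 2)
    with ((w * z ^ 2) / 2 - w * (w * z ^ 2) / 2 + w ^ 2 * (w * z ^ 2) / 3) by field.
  replace ((w ^ 3 / 12 - w ^ 4 / 4) * z ^ 4) with (w ^ 3 * z ^ 4 / 12 - w * (w ^ 3 * z ^ 4) / 4) by field.
  replace (w ^ 5 / 30 * z ^ 6) with (w ^ 5 * z ^ 6 / 30) by field.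
  replace (w ^ 5 * z ^ 4) with (w ^ 2 * (w ^ 3 * z ^ 4)) by ring.
  replace (w ^ 6 * z ^ 6) with (w * (w ^ 5 * z ^ 6)) by ring.
  set (y1 := w * z ^ 2) in *; set (y2 := w ^ 3 * z ^ 4) in *; set (y3 := w ^ 5 * z ^ 6) in *.
  set (y4 := w ^ 7 * z ^ 8) in *.
  assert (A1 : 0 <= w * y1 <= y1) by (split; nra).
  assert (A2 : 0 <= w ^ 2 * y1 <= y1) by (split; nra).
  assert (A3 : 0 <= w * y2 <= y1) by (split; nra).
  assert (A4 : 0 <= w ^ 2 * y2 <= y1) by (split; nra).
  assert (A5 : 0 <= w * y3 <= y1) by (split; nra).
  split; [apply Rabs_le|]; split; lra.
Qed.

Lemma self_info_bounds (k s : nat) : (s <= k)%nat -> 0 <= self_info k s <= INR k.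
Proof.
  intros Hs; unfold self_info.
  assert (Pl : prob_list (repeat (1 / 2) k)) by (apply prob_list_repeat; lra).
  assert (M1 := mass_le1 _ s Pl); assert (M2 := mass_half_ge k s Hs).
  assert (T : 0 < 2 ^ k) by (apply pow_lt; lra).
  assert (M0 : 0 < mass (repeat (1 / 2) k) s)
    by (assert (0 < / 2 ^ k) by (apply Rinv_0_lt_compat; exact T); lra).
  rewrite ln_Rinv by exact M0.
  apply ln_le in M1; [|exact M0]; apply ln_le in M2; [|apply Rinv_0_lt_compat; exact T].
  rewrite ln_1 in M1; rewrite ln_Rinv, ln_pow in M2 by lra.
  assert (L2 : ln 2 <= 1).
  { assert (E := exp_ineq1_le (ln 2)); rewrite exp_ln in E; lra. }
  assert (0 <= INR k) by apply pos_INR; nra.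
Qed.

Lemma self_info_expansion (k s : nat) : (8 <= k)%nat -> (s <= k)%nat ->
  Rabs (self_info k s - / 2 * ln (PI * INR k / 2) - main_term (/ INR k) (2 * INR s - INR k))
  <= 2000 * error_term (/ INR k) (2 * INR s - INR k).
Proof.
  intros Hk Hs.
  assert (X : 8 <= INR k) by (apply le_INR in Hk; simpl in Hk; lra).
  assert (Hs' := le_INR _ _ Hs); assert (S0 := pos_INR s).
  set (x := INR k) in *; set (z := 2 * INR s - x).
  assert (W : 0 <= / x <= 1).
  { split; [left; apply Rinv_0_lt_compat; lra|rewrite <- Rinv_1; apply Rinv_le_contravar; lra]. }
  assert (Wx : / x * x = 1) by (field; lra).
  assert (Uz : -1 <= / x * z <= 1) by (unfold z; split; nra).
  assert (Z : (/ x * z) ^ 2 <= 1) by nra.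
  destruct (main_error_term_bounds (/ x) z W Z) as [M E].
  destruct (Rle_dec (Rabs z) (x / 2)) as [C|C].
  - assert (H := self_info_center k s Hk Hs C); fold x in H; fold z in H; lra.
  (* Off the centre the left side is at most [4 x + 1], whereas [(/ x * z) ^ 2 >= 1/4] makes
     [error_term] at least [x / 256]; hence the factor 2000. *)
  - assert (B := self_info_bounds k s Hs); fold x in B.
    assert (P := PI_RGT_0); assert (P4 := PI_4).
    assert (P2 := PI2_1).
    assert (L : 0 <= ln (PI * x / 2) <= 2 * x).
    { assert (Q : 1 <= PI * x / 2) by nra.
      split; [rewrite <- ln_1; apply ln_le; lra|].
      assert (T := exp_ineq1_le (ln (PI * x / 2))); rewrite exp_ln in T by lra; nra. }
    assert (Y : / x * z ^ 2 <= x).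
    { replace (/ x * z ^ 2) with (x * (/ x * z) ^ 2) by (field; lra); nra. }
    assert (V : / 4 <= (/ x * z) ^ 2).
    { assert (Q : / 2 <= Rabs (/ x * z)).
      { rewrite Rabs_mult, (Rabs_pos_eq (/ x)) by lra; nra. }
      rewrite <- (pow2_abs (/ x * z)); nra. }
    assert (G : x / 256 <= error_term (/ x) z).
    { apply Rle_trans with ((/ x) ^ 7 * z ^ 8).
      - replace ((/ x) ^ 7 * z ^ 8) with (x * ((/ x * z) ^ 2) ^ 4) by (field; lra).
        apply Rle_trans with (x * (/ 4) ^ 4); [lra|].
        apply Rmult_le_compat_l; [lra|apply pow_incr; lra].
      - unfold error_term.
        assert (0 <= (/ x) ^ 3) by (apply pow_le; lra).
        assert (0 <= (/ x) ^ 5 * z ^ 4)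
          by (apply Rmult_le_pos; [apply pow_le; lra|apply (even_pow_ge0 z 2)]).
        assert (0 <= (/ x) ^ 6 * z ^ 6)
          by (apply Rmult_le_pos; [apply pow_le; lra|apply (even_pow_ge0 z 3)]).
        lra. }
    apply Rabs_le_between in M; apply Rabs_le; split; lra.
Qed.

(** * Entropy and varentropy of the symmetric binomial law *)

Lemma inv_INR_bounds (k : nat) : (1 <= k)%nat -> 0 < / INR k <= 1.
Proof.
  intros Hk; apply le_INR in Hk; simpl in Hk; split;
    [apply Rinv_0_lt_compat; lra|rewrite <- Rinv_1; apply Rinv_le_contravar; lra].
Qed.

Lemma scaled_sign_sum_le (k s : nat) : (1 <= k)%nat -> (s <= k)%nat ->
  (/ INR k * (2 * INR s - INR k)) ^ 2 <= 1.
Proof.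
  intros Hk Hs; assert (W := inv_INR_bounds k Hk).
  assert (E : / INR k * INR k = 1) by (apply Rinv_l, not_0_INR; lia).
  assert (Hs' := le_INR _ _ Hs); assert (S0 := pos_INR s).
  assert (-1 <= / INR k * (2 * INR s - INR k) <= 1) by (split; nra); nra.
Qed.

(** The pointwise error integrates to [2000 * 80000 * w ^ 3]; the extra 2 absorbs the cubic and
    quartic terms of [Esign_main_term]. *)
Lemma self_info_mean_expansion (k : nat) : (8 <= k)%nat ->
  Rabs (entropy (repeat (1 / 2) k)
    - (/ 2 * ln (PI * INR k / 2) + 1 / 2 - (/ INR k) ^ 2 / 12)) <= 160000002 * (/ INR k) ^ 3.
Proof.
  intros Hk; assert (W := inv_INR_bounds k ltac:(lia)).
  set (w := / INR k) in *; set (c0 := / 2 * ln (PI * INR k / 2)).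
  set (l := repeat (1 / 2) k).
  assert (Pl : prob_list l) by (apply prob_list_repeat; lra).
  set (z := fun s => 2 * INR s - INR k).
  assert (E : entropy l = c0 + Esign k (main_term w)
    + EF l (fun s => self_info k s - c0 - main_term w (z s))).
  { unfold Esign; fold l; rewrite <- (EF_const l c0), <- !EF_plus.
    apply EF_ext; intros s _; unfold z, self_info, l; rewrite EF_const; ring. }
  assert (R : Rabs (EF l (fun s => self_info k s - c0 - main_term w (z s))) <= 160000000 * w ^ 3).
  { apply Rle_trans with (EF l (fun s => 2000 * (error_term w (z s) * (3 * (w * z s ^ 2) + 1)))).
    - apply EF_abs_le; [exact Pl|]; intros s Hs; unfold l in Hs; rewrite repeat_length in Hs.
      eapply Rle_trans; [apply self_info_expansion; assumption|]; fold w; fold (z s).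
      destruct (main_error_term_bounds w (z s)) as [_ G];
        [lra|apply scaled_sign_sum_le; [lia|exact Hs]|].
      assert (0 <= w * z s ^ 2) by (apply Rmult_le_pos; [lra|apply pow2_ge_0]); nra.
    - rewrite EF_scal; assert (H := Esign_error_term k ltac:(lia)).
      unfold Esign in H; fold l in H; fold w in H; unfold z; lra. }
  rewrite E, Esign_main_term by lia; fold w.
  assert (H1 := pow_le_cube w 1 ltac:(lra)); assert (H0 := pow_le_cube w 0 ltac:(lra)).
  cbn [Nat.add] in H0, H1; apply Rabs_le_between in R; apply Rabs_le; lra.
Qed.

(** Centring at the leading logarithm keeps [ln k] out of the error. *)
Lemma self_info_second_moment_expansion (k : nat) : (8 <= k)%nat ->
  Rabs (EF (repeat (1 / 2) k) (fun s => (self_info k s - / 2 * ln (PI * INR k / 2)) ^ 2)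
    - (3 / 4 - / INR k / 2 - 7 / 12 * (/ INR k) ^ 2)) <= 400000000000 * (/ INR k) ^ 3.
Proof.
  intros Hk; assert (W := inv_INR_bounds k ltac:(lia)).
  set (w := / INR k) in *; set (c0 := / 2 * ln (PI * INR k / 2)).
  set (l := repeat (1 / 2) k).
  assert (Pl : prob_list l) by (apply prob_list_repeat; lra).
  set (z := fun s => 2 * INR s - INR k).
  assert (E : EF l (fun s => (self_info k s - c0) ^ 2) = Esign k (fun y => main_term w y ^ 2)
    + EF l (fun s => (self_info k s - c0) ^ 2 - main_term w (z s) ^ 2)).
  { unfold Esign; fold l; rewrite <- !EF_plus; apply EF_ext; intros s _; unfold z; ring. }
  assert (R : Rabs (EF l (fun s => (self_info k s - c0) ^ 2 - main_term w (z s) ^ 2))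
    <= 2002 * 2000 * 80000 * w ^ 3).
  { apply Rle_trans with (EF l (fun s => 2002 * 2000 * (error_term w (z s) * (3 * (w * z s ^ 2) + 1)))).
    - apply EF_abs_le; [exact Pl|]; intros s Hs; unfold l in Hs; rewrite repeat_length in Hs.
      assert (H := self_info_expansion k s Hk Hs); fold w in H; fold (z s) in H; fold c0 in H.
      destruct (main_error_term_bounds w (z s)) as [M G];
        [lra|apply scaled_sign_sum_le; [lia|exact Hs]|].
      set (r := self_info k s - c0 - main_term w (z s)) in *.
      set (d := 3 * (w * z s ^ 2) + 1) in *.
      (* With [d] bounding both [main_term] and [error_term], the first factor is at most
         [(2 + 2000) * d]. *)
      replace ((self_info k s - c0) ^ 2 - main_term w (z s) ^ 2)
        with ((2 * main_term w (z s) + r) * r) by (unfold r; ring).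
      rewrite Rabs_mult.
      apply Rle_trans with ((2002 * d) * (2000 * error_term w (z s))); [|right; ring].
      apply Rmult_le_compat; try apply Rabs_pos; [|exact H].
      eapply Rle_trans; [apply Rabs_triang|]; rewrite Rabs_mult, (Rabs_pos_eq 2); lra.
    - rewrite EF_scal; assert (H := Esign_error_term k ltac:(lia)).
      unfold Esign in H; fold l in H; fold w in H; unfold z; lra. }
  rewrite E, Esign_main_term_sqr by lia; fold w.
  assert (P := fun n => pow_le_cube w n ltac:(lra)).
  assert (P0 := P 0%nat); assert (P1 := P 1%nat); assert (P2 := P 2%nat); assert (P3 := P 3%nat).
  assert (P4 := P 4%nat); assert (P5 := P 5%nat); assert (P6 := P 6%nat).
  cbn [Nat.add] in P0, P1, P2, P3, P4, P5, P6.
  apply Rabs_le_between in R; apply Rabs_le; lra.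
Qed.

Lemma map_half (k : nat) : forall i, map half (seq i k) = repeat (1 / 2) k.
Proof. induction k as [|k IH]; intros i; simpl; [|rewrite IH]; reflexivity. Qed.

Lemma ln_PI_exp1 (x : R) : 0 < x -> ln (PI * exp 1 * x / 2) = ln (PI * x / 2) + 1.
Proof.
  intros Hx; assert (P := PI_RGT_0).
  assert (0 < PI * x) by (apply Rmult_lt_0_compat; lra).
  replace (PI * exp 1 * x / 2) with (PI * x / 2 * exp 1) by field.
  rewrite ln_mult, ln_exp by (apply exp_pos || lra); ring.
Qed.

(** The variance of the self-information may be computed around any [c]. With [c] the leading
    logarithm, only [delta * entropy ^ 2] still contains a logarithm. *)
Lemma Vdisp_half_centered (delta c : R) (k : nat) :
  Vdisp delta half k = (1 - delta) *
    (EF (repeat (1 / 2) k) (fun s => (self_info k s - c) ^ 2)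
     - (entropy (repeat (1 / 2) k) - c) ^ 2 + delta * entropy (repeat (1 / 2) k) ^ 2).
Proof.
  rewrite (Vdisp_entropy delta half k), map_half; set (l := repeat (1 / 2) k).
  rewrite (EF_ext l (fun s => (self_info k s - c) ^ 2)
    (fun s => (ln (/ mass l s) ^ 2 + (- 2 * c) * ln (/ mass l s)) + c ^ 2))
    by (intros; unfold self_info; fold l; ring).
  rewrite !EF_plus, EF_scal, EF_const; fold (entropy l); ring.
Qed.

(** Here [h] and [q] are the errors of the entropy and of the centred second moment, and [L] is
    [ln (pi e k / 2)]. The left side is the exact residual of the dispersion; [h * L] alone brings
    the logarithm into the error. *)
Lemma variance_error_bound (delta w h q L A B : R) :
  0 <= delta <= 1 -> 0 <= w <= 1 -> 0 <= L ->
  Rabs h <= A * w ^ 3 -> Rabs q <= B * w ^ 3 ->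
  Rabs ((1 - delta) * (q - w ^ 4 / 144 - h ^ 2 - h + h * w ^ 2 / 6
    + delta * (w ^ 4 / 144 + h ^ 2 + h * L - h * w ^ 2 / 6)))
  <= w ^ 3 * (B + 1 + 2 * A ^ 2 + 3 * A + A * L).
Proof.
  intros Hd Hw HL Hh Hq.
  assert (W3 := pow_le_cube w 0 Hw); assert (W4 := pow_le_cube w 1 Hw).
  assert (W6 := pow_le_cube w 3 Hw); cbn [Nat.add] in W3, W4, W6.
  assert (W2 : 0 <= w ^ 2 <= 1) by (split; [apply pow_le; lra|nra]).
  set (a := A * w ^ 3) in *; set (b := B * w ^ 3) in *.
  assert (H0 := Rabs_pos h).
  assert (H2 : 0 <= h ^ 2 <= A ^ 2 * w ^ 3).
  { split; [apply pow2_ge_0|]; rewrite <- pow2_abs.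
    apply Rle_trans with (a ^ 2); [apply pow_incr; split; lra|].
    unfold a; replace ((A * w ^ 3) ^ 2) with (A ^ 2 * w ^ 6) by ring.
    apply Rmult_le_compat_l; [apply pow2_ge_0|lra]. }
  apply Rabs_le_between in Hh; apply Rabs_le_between in Hq.
  assert (HW : - a <= h * w ^ 2 <= a) by (split; nra).
  assert (HLa : - (a * L) <= h * L <= a * L) by (split; nra).
  set (y := w ^ 4 / 144 + h ^ 2 + h * L - h * w ^ 2 / 6) in *.
  assert (Yd : Rabs (delta * y) <= Rabs y).
  { rewrite Rabs_mult, (Rabs_pos_eq delta) by lra; assert (0 <= Rabs y) by apply Rabs_pos; nra. }
  apply Rabs_le_between in Yd.
  assert (Y0 : Rabs y <= w ^ 3 / 144 + A ^ 2 * w ^ 3 + a * L + a)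
    by (apply Rabs_le; unfold y; split; lra).
  match goal with |- Rabs (_ * ?X) <= _ =>
    apply Rle_trans with (Rabs X);
    [rewrite Rabs_mult, (Rabs_pos_eq (1 - delta)) by lra;
     assert (0 <= Rabs X) by apply Rabs_pos; nra|] end.
  replace (w ^ 3 * (B + 1 + 2 * A ^ 2 + 3 * A + A * L))
    with (b + w ^ 3 + 2 * (A ^ 2 * w ^ 3) + 3 * a + a * L) by (unfold a, b; ring).
  apply Rabs_le; split; lra.
Qed.

(** [pi e / 2 <= 8 = 2^3] and [1 <= 2 ln 2] bound the left side by [5 ln 2 + ln k]. This absorbs the
    constant into [ln k]. *)
Lemma one_plus_ln_le (k : nat) : (2 <= k)%nat ->
  0 <= ln (PI * exp 1 * INR k / 2) /\
  1 + ln (PI * exp 1 * INR k / 2) <= 6 * ln (INR k).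
Proof.
  intros Hk; assert (K : 2 <= INR k) by (apply le_INR in Hk; simpl in Hk; lra).
  assert (P := PI_RGT_0); assert (P4 := PI_4); assert (P2 := PI2_1); assert (E3 := exp_le_3).
  assert (E1 := exp_ineq1_le 1); assert (L2 := ln_lt_2).
  assert (Q : 2 <= PI * exp 1 / 2 <= 8) by (split; nra).
  replace (PI * exp 1 * INR k / 2) with (PI * exp 1 / 2 * INR k) by field.
  rewrite ln_mult by lra.
  assert (L8 : ln (PI * exp 1 / 2) <= 3 * ln 2).
  { replace (3 * ln 2) with (ln 8); [apply ln_le; lra|].
    replace 8 with (2 ^ 3) by ring; rewrite ln_pow by lra; simpl; ring. }
  assert (L0 : ln 1 <= ln (PI * exp 1 / 2)) by (apply ln_le; lra); rewrite ln_1 in L0.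
  assert (LK : ln 2 <= ln (INR k)) by (apply ln_le; lra).
  split; lra.
Qed.

Theorem theorem6 (delta : R) (Hd : 0 <= delta <= 1) :
  (forall (k : nat) (p : nat -> R),
      (forall i, (i < k)%nat -> 0 <= p i <= 1) ->
      MI delta p k <= MI delta half k) /\
  (exists C : R, exists K : nat, forall k : nat, (K <= k)%nat -> (1 <= k)%nat ->
      Rabs (MI delta half k
            - (1 - delta) * (/ 2 * ln (PI * exp 1 * INR k / 2) - / (12 * INR k ^ 2)))
      <= C / INR k ^ 3) /\
  (exists C : R, exists K : nat, forall k : nat, (K <= k)%nat -> (2 <= k)%nat ->
      Rabs (Vdisp delta half k
            - (1 - delta) * (delta / 4 * (ln (PI * exp 1 * INR k / 2)) ^ 2 + / 2
                             - / (2 * INR k)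
                             - (/ 2 + delta * ln (PI * exp 1 * INR k / 2) / 12)
                               * / INR k ^ 2))
      <= C * ln (INR k) / INR k ^ 3).
Proof.
  split; [|split].
  - intros k p Hp; rewrite !MI_entropy, map_half.
    apply Rmult_le_compat_l; [lra|].
    assert (Pl : prob_list (map p (seq 0 k))).
    { apply Forall_forall; intros x Hx; apply in_map_iff in Hx.
      destruct Hx as [i [<- Hi]]; apply in_seq in Hi; apply Hp; lia. }
    assert (H := entropy_le_half _ Pl); rewrite length_map, length_seq in H; exact H.
  - exists 160000002, 8%nat; intros k Hk _.
    assert (K : 0 < INR k) by (apply lt_0_INR; lia).
    rewrite MI_entropy, map_half, ln_PI_exp1 by exact K.
    assert (H := self_info_mean_expansion k Hk).
    match type of H with Rabs ?X <= _ => set (h := X) in H end.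
    match goal with |- Rabs ?X <= _ => replace X with ((1 - delta) * h) by (unfold h; field; lra) end.
    replace (160000002 / INR k ^ 3) with (160000002 * (/ INR k) ^ 3) by (field; lra).
    rewrite Rabs_mult, (Rabs_pos_eq (1 - delta)) by lra.
    assert (0 <= Rabs h) by apply Rabs_pos; nra.
  - set (A := 160000002); set (B := 400000000000).
    exists (6 * (B + 1 + 2 * A ^ 2 + 3 * A)), 8%nat; intros k Hk Hk2.
    assert (K : 0 < INR k) by (apply lt_0_INR; lia).
    assert (W := inv_INR_bounds k ltac:(lia)).
    destruct (one_plus_ln_le k Hk2) as [L0 L1].
    rewrite (Vdisp_half_centered delta (/ 2 * ln (PI * INR k / 2)) k).
    assert (H1 := self_info_mean_expansion k Hk).
    assert (H2 := self_info_second_moment_expansion k Hk).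
    rewrite ln_PI_exp1 in * by exact K.
    set (c := ln (PI * INR k / 2)) in *.
    match type of H1 with Rabs ?X <= _ => set (h := X) in H1 end.
    match type of H2 with Rabs ?X <= _ => set (q := X) in H2 end.
    assert (V := variance_error_bound delta (/ INR k) h q (c + 1) A B Hd ltac:(lra) L0 H1 H2).
    (* Expanding the squares shows that every explicit term of the claim cancels, leaving exactly
       the residual bounded in [V]. *)
    match type of V with Rabs ?X <= _ => match goal with |- Rabs ?Y <= _ =>
      replace Y with X by (unfold h, q; field; lra) end end.
    eapply Rle_trans; [exact V|].
    set (D := B + 1 + 2 * A ^ 2 + 3 * A).
    replace (6 * D * ln (INR k) / INR k ^ 3) with ((/ INR k) ^ 3 * (D * (6 * ln (INR k))))
      by (field; lra).
    apply Rmult_le_compat_l; [apply pow_le; lra|].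
    apply Rle_trans with (D * (1 + (c + 1))); [|apply Rmult_le_compat_l; [unfold D, A, B; lra|exact L1]].
    assert (A * (c + 1) <= D * (c + 1)) by (apply Rmult_le_compat_r; [exact L0|unfold D, A, B; lra]).
    unfold D in *; lra.
Qed.
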